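(* Let $d\ge3$ and consider the Rademacher prior $\mathcal X_{\mathrm{Rade}}$ (the entries of $x\in\mathbb R^n$ are i.i.d. uniform on $\{\pm1/\sqrt n\}$). Let $$f_{\mathcal X_{\mathrm{Rade}}}(t)=\log2-H\left(\frac{1+t}{2}\right),\qquad H(p)=-p\log p-(1-p)\log(1-p),$$ and let $\lambda^*_{\mathrm{Rade},d}$ be the supremum of all values $\lambda^*$ for which $$\frac{(\lambda^* )^2}{2}\frac{t^d}{1+t^d}\le f_{\mathcal X_{\mathrm{Rade}}}(t)\qquad\forall t\in[0,1).$$ Then weak detection and weak recovery are impossible for $\mathrm{WT}(d,\lambda,\mathcal X_{\mathrm{Rade}})$ for all $\lambda<\lambda^*_{\mathrm{Rade},d}$.
   Context: Wigner tensor: for integers $d\ge2$, $n\ge1$, $\mathrm{WT}(d)=\mathrm{WT}_n(d)$ is the law of the symmetric tensor $W\in(\mathbb R^n)^{\otimes d}$ obtained by drawing $W'\in\mathbb R^{n^d}$ with i.i.d. $\mathcal N(0,2/n)$ entries and averaging it over all $d!$ permutations of the indices. Spiked model: for a family $\mathcal X=\{\mathcal X_n\}$ of distributions on unit vectors of $\mathbb R^n$ and $\lambda\ge0$ (not depending on $n$), $\mathrm{WT}(d,\lambda,\mathcal X)$ is the law of $T=\lambda x^{\otimes d}+W$ with $x\sim\mathcal X_n$ and $W\sim\mathrm{WT}_n(d)$ independent. All statements are in the limit $n\to\infty$ with $d,\lambda$ fixed. Weak detection: given a single sample from either $\mathrm{WT}(d,\lambda,\mathcal X)$ or $\mathrm{WT}(d)$,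 each chosen with probability $1/2$, decide which one with success probability at least $\frac12+\varepsilon$ as $n\to\infty$, for some $\varepsilon>0$ not depending on $n$. Weak recovery: given a sample $T$ from $\mathrm{WT}(d,\lambda,\mathcal X)$, output a unit vector $\hat x=\hat x(T)$ with $\mathbb E[\langle x,\hat x\rangle^d]\ge\varepsilon$ as $n\to\infty$, for some $\varepsilon>0$ not depending on $n$. There is no computational restriction. *)

(* Defs.v *)
From HB Require Import structures.
From mathcomp Require Import all_boot all_order all_algebra all_fingroup.
From mathcomp Require Import all_classical all_reals all_analysis.
From mathcomp Require Import measurable_realfun.

Set Implicit Arguments.
Unset Strict Implicit.
Unset Printing Implicit Defensive.

Import Order.TTheory GRing.Theory Num.Theory.
Import numFieldNormedType.Exports.

Local Open Scope classical_set_scope.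
Local Open Scope ring_scope.

Section iid.
Context (disp : measure_display) (T : measurableType disp) (R : realType).

Definition pair_cons (k : nat) (z : T * k.-tuple T) : k.+1.-tuple T :=
  [tuple of z.1 :: z.2].

Lemma measurable_pair_cons k : measurable_fun setT (@pair_cons k).
Proof. exact: measurable_cons. Qed.

HB.instance Definition _ k :=
  isMeasurableFun.Build _ _ _ _ (@pair_cons k) (@measurable_pair_cons k).

(* The k-fold product measure of P on the product sigma-algebra, i.e. the law
   of k independent draws from P. *)
Fixpoint iid (P : probability T R) (k : nat) : probability (k.-tuple T) R :=
  match k return probability (k.-tuple T) R with
  | 0 => \d_([tuple] : 0.-tuple T)
  | k'.+1 => distribution (P \x iid P k')%E (@pair_cons k')
  end.

End iid.

Section tensors.
Context (R : realType).

Definition vec (n : nat) := n.-tuple R.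

Definition dot (n : nat) (x y : vec n) : R := \sum_(i < n) tnth x i * tnth y i.

Definition is_unit_vector (n : nat) (x : vec n) : Prop := dot x x = 1.

(* A tensor in (R^n)^{(x) d} is the tuple of its n ^ d entries, which are indexed
   by functions a : 'I_d -> 'I_n; tuples carry the product (Borel)
   sigma-algebra. *)
Definition tindex (d n : nat) := {ffun 'I_d -> 'I_n}.

Definition tensor (d n : nat) := #|{: tindex d n}|.-tuple R.

Definition tentry (d n : nat) (T : tensor d n) (a : tindex d n) : R :=
  tnth T (enum_rank a).

Definition mktensor (d n : nat) (F : tindex d n -> R) : tensor d n :=
  [tuple F (enum_val j) | j < #|{: tindex d n}|].

Lemma tentry_mktensor d n (F : tindex d n -> R) a : tentry (mktensor F) a = F a.
Proof. by rewrite /tentry tnth_mktuple enum_rankK. Qed.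

Definition tensor_sym (d n : nat) (T : tensor d n) : tensor d n :=
  mktensor (fun a => (d`!%:R)^-1 *
    \sum_(s : 'S_d) tentry T [ffun k => a (s k)]).

Definition tensor_pow (d n : nat) (x : vec n) : tensor d n :=
  mktensor (fun a => \prod_(k < d) tnth x (a k)).

Definition spike (d n : nat) (lam : R) (z : vec n * tensor d n) : tensor d n :=
  mktensor (fun a => lam * tentry (tensor_pow d z.1) a + tentry z.2 a).

Lemma measurable_tensor_sym d n : measurable_fun setT (@tensor_sym d n).
Proof.
apply/measurable_fun_tnthP => j.
rewrite (_ : _ \o _ = fun T : tensor d n => (d`!%:R)^-1 *
    \sum_(s : 'S_d) tentry T [ffun k => enum_val j (s k)]); last first.
  by apply/funext => T /=; rewrite tnth_mktuple.
apply: measurable_funM => //; apply: measurable_sum => s.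
exact: measurable_tnth.
Qed.

HB.instance Definition _ d n :=
  isMeasurableFun.Build _ _ _ _ (@tensor_sym d n) (@measurable_tensor_sym d n).

Lemma measurable_spike d n lam : measurable_fun setT (@spike d n lam).
Proof.
apply/measurable_fun_tnthP => j.
rewrite (_ : _ \o _ = fun z : vec n * tensor d n =>
    lam * (\prod_(k < d) tnth z.1 (enum_val j k)) + tnth z.2 j); last first.
  apply/funext => z /=.
  by rewrite tnth_mktuple tentry_mktensor /tentry enum_valK.
apply: measurable_funD.
  apply: measurable_funM => //; apply: measurable_prod => k _.
  exact: (measurableT_comp (measurable_tnth (enum_val j k)) measurable_fst).
exact: (measurableT_comp (measurable_tnth j) measurable_snd).
Qed.

HB.instance Definition _ d n lam :=
  isMeasurableFun.Build _ _ _ _ (@spike d n lam) (@measurable_spike d n lam).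

End tensors.

Section spiked_model.
Context (R : realType).

(* normal_prob lives on measurableTypeR R, which has the same carrier and
   measurable sets as R but another display; the identity transports it to R. *)
Definition of_measurableTypeR (x : measurableTypeR R) : R := x.

Lemma measurable_of_measurableTypeR : measurable_fun setT of_measurableTypeR.
Proof. exact: measurable_id. Qed.

HB.instance Definition _ :=
  isMeasurableFun.Build _ _ _ _ of_measurableTypeR measurable_of_measurableTypeR.

(* N(0, v); the second parameter of normal_prob is the standard deviation. *)
Definition centered_gaussian (v : R) : probability R R :=
  distribution (normal_prob 0 (Num.sqrt v)) of_measurableTypeR.

Definition WT (d n : nat) : probability (tensor R d n) R :=
  distribution
    (iid (centered_gaussian (2 / n%:R)) #|{: tindex d n}|) (@tensor_sym R d n).

Definition prior := forall n : nat, probability (vec R n) R.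

(* The joint law of the signal x and the independent noise W. *)
Definition signal_noise (d : nat) (X : prior) (n : nat) :
    probability (vec R n * tensor R d n)%type R :=
  (X n \x WT d n)%E.

Definition spikedWT (d : nat) (lam : R) (X : prior) (n : nat) :
    probability (tensor R d n) R :=
  distribution (signal_noise d X n) (@spike R d n lam).

(* A test is given by the set A of samples it declares to be spiked. *)
Definition success_prob (d : nat) (lam : R) (X : prior) (n : nat)
    (A : set (tensor R d n)) : \bar R :=
  ((2^-1)%:E * spikedWT d lam X n A + (2^-1)%:E * WT d n (~` A))%E.

Definition weak_detection (d : nat) (lam : R) (X : prior) : Prop :=
  exists eps : R, 0 < eps /\
  exists A : forall n : nat, set (tensor R d n),
    (forall n, measurable (A n)) /\
    \forall n \near \oo, ((2^-1 + eps)%:E <= success_prob lam X (A n))%E.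

(* There is no unit vector in dimension 0, hence the guard (0 < n)%N. *)
Definition weak_recovery (d : nat) (lam : R) (X : prior) : Prop :=
  exists eps : R, 0 < eps /\
  exists xhat : forall n : nat, tensor R d n -> vec R n,
    (forall n, measurable_fun setT (xhat n)) /\
    (forall n, (0 < n)%N -> forall T, is_unit_vector (xhat n T)) /\
    \forall n \near \oo,
      (eps%:E <= 'E_(signal_noise d X n)[
                    (fun z => dot z.1 (xhat n (spike lam z)) ^+ d)%R])%E.

End spiked_model.

Section rademacher_prior.
Context (R : realType).

Definition rade_entry (n : nat) (b : bool) : R :=
  (if b then 1 else -1) / Num.sqrt n%:R.

Lemma measurable_rade_entry n : measurable_fun setT (rade_entry n).
Proof. by []. Qed.

HB.instance Definition _ n :=
  isMeasurableFun.Build _ _ _ _ (rade_entry n) (@measurable_rade_entry n).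

Definition rademacher : prior R := fun n =>
  iid (distribution (bernoulli_prob (2^-1 : R) : probability bool R)
                    (rade_entry n)) n.

Definition binary_entropy (p : R) : R :=
  - p * ln p - (1 - p) * ln (1 - p).

Definition f_rade (t : R) : R := ln 2 - binary_entropy ((1 + t) / 2).

Definition lambda_rade (d : nat) : R :=
  sup [set l : R | forall t : R, 0 <= t < 1 ->
         l ^+ 2 / 2 * (t ^+ d / (1 + t ^+ d)) <= f_rade t].

End rademacher_prior.

(* Main.v *)
(** Second moment method with conditioned noise. Undoing the symmetrization, the
    noise [G] is i.i.d. Gaussian and a spike [x] has likelihood ratio
    [L_x = exp (n/2 (lam g_x - lam^2/2))], [g_x = <G, x^{(x) d}>]. Truncate [L_x] to
    the event [g_x <= lam + eta], whose complement has probability at most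
    [exp (- n eta^2/4)] under the spiked law. Put [t = <x, x'>] and [r = |t|^d].
    A Chernoff bound with slope [lam r/(1+r)] bounds the correlation of two
    truncated ratios by [exp (n (lam^2/2 + lam eta) r/(1+r))], which is at most
    [exp (c n f(t))] with [c < 1] because [lam] is below the threshold, while the
    overlap [t] has probability at most [exp (- n f(t))], and [f(t) >= t^2/6].
    Hence overlaps [|t| > delta] contribute [o(1)] and overlaps [|t| <= delta]
    contribute [1 + o(1)], provided [n delta^3] tends to [0] and [n delta^2]
    dominates [log n]. It suffices to refute both tasks along a subsequence, so take
    [n = m^5], [delta = m^-2]. Thus the averaged truncated likelihood ratio tends to
    [1] in L2, which rules out detection; weighting the pairs by [|t|^d] makes the
    second moment vanish, which rules out recovery by Cauchy-Schwarz for tensors. *)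

Require Import Defs.
From HB Require Import structures.
From mathcomp Require Import all_boot all_order all_algebra all_fingroup.
From mathcomp Require Import all_classical all_reals all_analysis.
From mathcomp Require Import measurable_realfun ring lra.
Import Order.TTheory GRing.Theory Num.Theory.
Import numFieldNormedType.Exports.
Set Implicit Arguments.
Unset Strict Implicit.
Unset Printing Implicit Defensive.
Local Open Scope classical_set_scope.
Local Open Scope ring_scope.

(** * Gaussian shifts *)

Section gaussian_shift.
Context {R : realType}.
Local Notation mu := (@lebesgue_measure R).
Local Open Scope ereal_scope.

(** The Radon-Nikodym derivative of [normal_prob m s] and [normal_pdf m s] have the same integral
    over every measurable set, hence agree almost everywhere. *)
Lemma ge0_integral_normal_prob (m s : R) (F : R -> \bar R) :
  measurable_fun setT F -> (forall x, 0 <= F x) ->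
  \int[normal_prob m s]_x F x = \int[mu]_x (F x * (normal_pdf m s x)%:E).
Proof.
move=> mF F0.
have dom := normal_prob_dominates m s.
rewrite -(Radon_Nikodym_SigmaFinite.change_of_variables dom)//.
have mpdf : measurable_fun setT (fun x => (normal_pdf m s x)%:E).
  by apply/measurable_EFinP; exact: measurable_normal_pdf.
have mRN := measurable_int _ (Radon_Nikodym_SigmaFinite.f_integrable dom).
apply: ge0_ae_eq_integral => //.
- exact: emeasurable_funM.
- exact: emeasurable_funM.
- by move=> x _; rewrite mule_ge0// Radon_Nikodym_SigmaFinite.f_ge0.
- by move=> x _; rewrite mule_ge0// lee_fin normal_pdf_ge0.
apply: ae_eqe_mul2l; apply: integral_ae_eq => //.
- exact: (Radon_Nikodym_SigmaFinite.f_integrable dom).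
- by move=> E _ mE; rewrite -(Radon_Nikodym_SigmaFinite.f_integral dom).
Qed.

Let measurable_addr (u : R) : measurable_fun setT (fun x : R => (x + u)%R).
Proof. by apply: measurable_funD. Qed.

(** Translation invariance: the pushforward agrees with Lebesgue measure on half-open intervals, and
    these determine it. *)
Lemma lebesgue_measureDr (u : R) (A : set R) : measurable A ->
  pushforward mu ((fun x => x + u)%R : _ -> measurableTypeR R) A = mu A.
Proof.
move=> mA.
have mD : measurable_fun setT ((fun x => x + u)%R : measurableTypeR R -> measurableTypeR R).
  exact: measurable_addr.
pose f : {mfun measurableTypeR R >-> measurableTypeR R} :=
  HB.pack ((fun x => x + u)%R : measurableTypeR R -> measurableTypeR R)
    (isMeasurableFun.Build _ _ _ _ _ mD).
rewrite -[LHS]/(pushforward mu f A).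
apply/esym/lebesgue_measure_unique => //= _ [[a b]] _ <-.
rewrite /pushforward (_ : _ @^-1` _ = `](a - u)%R, (b - u)%R]%classic); last first.
  by apply/seteqP; split => x /=; rewrite !in_itv/= ltrBlDr lerBrDr.
by rewrite !lebesgue_measure_itv/= !lte_fin ltrD2r -!EFinB opprB addrA subrK.
Qed.

Lemma ge0_integralDr (u : R) (F : R -> \bar R) :
  measurable_fun setT F -> (forall x, 0 <= F x) ->
  \int[mu]_x F (x + u)%R = \int[mu]_x F x.
Proof.
move=> mF F0.
have mD : measurable_fun setT ((fun x => x + u)%R : measurableTypeR R -> measurableTypeR R).
  exact: measurable_addr.
transitivity (\int[pushforward mu
    ((fun x => x + u)%R : measurableTypeR R -> measurableTypeR R)]_x F x).
  by rewrite ge0_integral_pushforward// preimage_setT.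
by apply: eq_measure_integral => A mA _; exact: lebesgue_measureDr.
Qed.

Lemma ge0_integral_gaussian (v : R) (F : R -> \bar R) :
  measurable_fun setT F -> (forall x, 0 <= F x) ->
  \int[centered_gaussian v]_x F x = \int[mu]_x (F x * (normal_pdf 0 (Num.sqrt v) x)%:E).
Proof.
move=> mF F0.
rewrite /centered_gaussian ge0_integral_distribution//.
exact: ge0_integral_normal_prob.
Qed.

(** One-dimensional Cameron-Martin formula: translate the Lebesgue integral; the exponential is the
    ratio of the densities of N(u, v) and N(0, v). *)
Lemma gaussian_shift (v u : R) (F : R -> \bar R) : (0 < v)%R ->
  measurable_fun setT F -> (forall x, 0 <= F x) ->
  \int[centered_gaussian v]_x F (x + u)%R =
  \int[centered_gaussian v]_x (F x * (expR ((x * u - u ^+ 2 / 2) / v))%:E).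
Proof.
move=> v0 mF F0.
have s0 : (Num.sqrt v != 0)%R by rewrite gt_eqF// sqrtr_gt0.
have mw : measurable_fun setT (fun x : R => (expR ((x * u - u ^+ 2 / 2) / v))%:E).
  apply/measurable_EFinP; apply: measurableT_comp => //.
  by apply: measurable_funM => //; apply: measurable_funB => //; apply: measurable_funM.
have mN : measurable_fun setT (normal_pdf 0 (Num.sqrt v)) by exact: measurable_normal_pdf.
rewrite !ge0_integral_gaussian//; last 3 first.
- by apply: emeasurable_funM => //.
- by move=> x; rewrite mule_ge0// lee_fin expR_ge0.
- by apply: measurableT_comp => //; apply: measurable_funD.
pose H (y : R) := F y * (normal_pdf 0 (Num.sqrt v) (y - u))%:E.
transitivity (\int[mu]_x H (x + u)%R).
  by apply: eq_integral => x _; rewrite /H addrK.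
rewrite ge0_integralDr; last 2 first.
- apply: emeasurable_funM => //; apply/measurable_EFinP.
  by apply: measurableT_comp => //; apply: measurable_funB.
- by move=> x; rewrite mule_ge0// lee_fin normal_pdf_ge0.
apply: eq_integral => x _; rewrite /H -muleA; congr (_ * _).
rewrite -EFinM normal_pdfE// mulrCA -expRD; congr (_ * expR _)%:E.
by rewrite sqr_sqrtr ?ltW//; field; rewrite gt_eqF.
Qed.

End gaussian_shift.

(** * Product laws *)

Section iid_integral.
Context {R : realType}.
Local Open Scope ereal_scope.

Lemma ge0_integral_iid0 d (T : measurableType d) (P : probability T R)
    (F : 0.-tuple T -> \bar R) :
  measurable_fun setT F -> \int[iid P 0]_t F t = F [tuple].
Proof.
by move=> mF; rewrite [LHS]integral_dirac// diracT mul1e.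
Qed.

Lemma ge0_integral_iidS d (T : measurableType d) (P : probability T R) k
    (F : k.+1.-tuple T -> \bar R) :
  measurable_fun setT F -> (forall t, 0 <= F t) ->
  \int[iid P k.+1]_t F t = \int[P]_x \int[iid P k]_t F (pair_cons (x, t)).
Proof.
move=> mF F0.
rewrite [LHS]ge0_integral_distribution//.
have mFp : measurable_fun setT (F \o @pair_cons _ T k).
  by apply: (measurableT_comp mF); exact: measurable_pair_cons.
rewrite fubini_tonelli1//.
by move=> x; exact: F0.
Qed.

Definition tshift N (t u : N.-tuple R) : N.-tuple R :=
  [tuple (tnth t i + tnth u i)%R | i < N].

Lemma tshift_cons N (x a : R) (t u : N.-tuple R) :
  tshift (pair_cons (x, t)) [tuple of a :: u] = pair_cons ((x + a)%R, tshift t u).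
Proof.
apply: eq_from_tnth => i; rewrite tnth_mktuple /pair_cons.
by case: (unliftP ord0 i) => [j|] ->; rewrite /= ?tnth0// !tnthS tnth_mktuple.
Qed.

Lemma measurable_tshift N (u : N.-tuple R) : measurable_fun setT (fun t => tshift t u).
Proof.
apply/measurable_fun_tnthP => i.
rewrite (_ : _ \o _ = fun t => (tnth t i + tnth u i)%R); last first.
  by apply/funext => t /=; rewrite tnth_mktuple.
by apply: measurable_funD => //; exact: measurable_tnth.
Qed.

Lemma dot_cons N (x a : R) (t u : N.-tuple R) :
  dot (pair_cons (x, t)) [tuple of a :: u] = (x * a + dot t u)%R.
Proof.
by rewrite /dot big_ord_recl/= !tnth0; congr +%R; apply: eq_bigr => i _; rewrite !tnthS.
Qed.

Lemma measurable_dot N (u : N.-tuple R) : measurable_fun setT (fun t : N.-tuple R => dot t u).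
Proof.
apply: measurable_sum => i; apply: measurable_funM => //; exact: measurable_tnth.
Qed.

(** Density of the law of t + u with respect to that of t, when the entries of t are independent
    N(0, v). *)
Definition gauss_tilt (v : R) N (u t : N.-tuple R) : R :=
  expR ((dot t u - dot u u / 2) / v).

Lemma gauss_tilt_cons (v x a : R) N (u t : N.-tuple R) :
  gauss_tilt v [tuple of a :: u] (pair_cons (x, t)) =
  (expR ((x * a - a ^+ 2 / 2) / v) * gauss_tilt v u t)%R.
Proof.
rewrite /gauss_tilt -expRD !dot_cons; congr expR.
rewrite -mulrDl; congr (_ / _)%R.
by lra.
Qed.

Lemma measurable_gauss_tilt (v : R) N (u : N.-tuple R) :
  measurable_fun setT (gauss_tilt v u).
Proof.
apply: measurableT_comp => //; apply: measurable_funM => //.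
by apply: measurable_funB => //; exact: measurable_dot.
Qed.

Lemma gauss_tilt_ge0 (v : R) N (u t : N.-tuple R) : (0 <= gauss_tilt v u t)%R.
Proof. exact: expR_ge0. Qed.

(** Induction on the coordinates: the tail is shifted inside the integral over the first entry,
    which is then shifted by the one-dimensional formula; the tilts multiply. *)
Lemma iid_gaussian_shift (v : R) N (u : N.-tuple R) (F : N.-tuple R -> \bar R) :
  (0 < v)%R -> measurable_fun setT F -> (forall t, 0 <= F t) ->
  \int[iid (centered_gaussian v) N]_t F (tshift t u) =
  \int[iid (centered_gaussian v) N]_t (F t * (gauss_tilt v u t)%:E).
Proof.
move=> v0; elim: N u F => [u F mF F0|k IH u F mF F0].
  rewrite !ge0_integral_iid0//; last 2 first.
  - apply: emeasurable_funM => //; apply/measurable_EFinP.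
    exact: measurable_gauss_tilt.
  - by apply: (measurableT_comp mF); exact: measurable_tshift.
  rewrite /gauss_tilt /dot !big_ord0 mul0r subr0 mul0r expR0 mule1.
  by congr F; apply: eq_from_tnth; case.
case/tupleP: u => a u.
have mw : measurable_fun setT (fun t => (gauss_tilt v u t)%:E).
  by apply/measurable_EFinP; exact: measurable_gauss_tilt.
have mFp : measurable_fun setT (F \o @pair_cons _ R k).
  by apply: (measurableT_comp mF); exact: measurable_pair_cons.
have mFx x : measurable_fun setT (fun t => F (pair_cons (x, t))).
  by apply: (measurableT_comp mFp); exact: measurable_pair1.
rewrite ge0_integral_iidS; last 2 first.
- by apply: (measurableT_comp mF); exact: measurable_tshift.
- by move=> t; exact: F0.
rewrite ge0_integral_iidS; last 2 first.
- apply: emeasurable_funM mF _; apply/measurable_EFinP.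
  exact: measurable_gauss_tilt.
- by move=> t; rewrite mule_ge0// lee_fin gauss_tilt_ge0.
pose H (z : R * k.-tuple R) := F (pair_cons z) * (gauss_tilt v u z.2)%:E.
have mH : measurable_fun setT H.
  apply: emeasurable_funM; first exact: mFp.
  by apply: (measurableT_comp mw).
have H0 z : 0 <= H z by rewrite mule_ge0// lee_fin gauss_tilt_ge0.
pose G (x : R) := \int[iid (centered_gaussian v) k]_t H (x, t).
have mG : measurable_fun setT G by exact: measurable_fun_fubini_tonelli_F.
transitivity (\int[centered_gaussian v]_x G (x + a)%R).
  apply: eq_integral => x _; rewrite /G /H -IH//.
  by apply: eq_integral => t _; rewrite tshift_cons.
have G0 x : 0 <= G x by exact: integral_ge0.
apply: etrans (gaussian_shift a v0 mG G0) _.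
apply: eq_integral => x _.
have mHx : measurable_fun setT (fun t => H (x, t)).
  by apply: (measurableT_comp mH); exact: measurable_pair1.
rewrite muleC -ge0_integralZl//.
apply: eq_integral => t _.
by rewrite gauss_tilt_cons /H EFinM muleCA.
Qed.

Lemma integral_gauss_tilt (v : R) N (u : N.-tuple R) : (0 < v)%R ->
  \int[iid (centered_gaussian v) N]_t (gauss_tilt v u t)%:E = 1.
Proof.
move=> v0; transitivity (\int[iid (centered_gaussian v) N]_t (cst 1 (tshift t u))).
  rewrite (@iid_gaussian_shift _ _ u (cst 1))//.
  by apply: eq_integral => t _; rewrite mul1e.
by rewrite integral_cst//= mul1e probability_setT.
Qed.

End iid_integral.

Lemma big_tupleS (S : Type) (idx : S) (op : Monoid.com_law idx) (T : finType) k
    (F : k.+1.-tuple T -> S) :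
  \big[op/idx]_b F b = \big[op/idx]_a \big[op/idx]_(b : k.-tuple T) F [tuple of a :: b].
Proof.
rewrite pair_big/=.
rewrite (reindex (fun p : T * k.-tuple T => [tuple of p.1 :: p.2]))//=.
exists (fun t => (thead t, behead_tuple t)) => [[a b] _|t _] /=.
  by rewrite theadE; congr pair; apply: val_inj.
by case/tupleP: t => a b; apply: val_inj.
Qed.

Lemma sum_tuple_prod (R : comPzRingType) (T : finType) n (f : 'I_n -> T -> R) :
  \sum_(b : n.-tuple T) \prod_(i < n) f i (tnth b i) = \prod_(i < n) \sum_c f i c.
Proof.
elim: n f => [|n IH] f.
  rewrite big_ord0 (eq_bigr (fun=> 1)) => [|b _]; last by rewrite big_ord0.
  by rewrite sumr_const card_tuple.
rewrite big_tupleS big_ord_recl/= mulr_suml; apply: eq_bigr => a _.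
rewrite -IH mulr_sumr; apply: eq_bigr => b _.
by rewrite big_ord_recl tnth0; congr (_ * _); apply: eq_bigr => i _; rewrite tnthS.
Qed.

(** * Integration against the Rademacher prior *)

Section rademacher_integral.
Context {R : realType}.
Local Open Scope ereal_scope.

Definition rade_vec n (b : n.-tuple bool) : vec R n :=
  [tuple rade_entry R n (tnth b i) | i < n].

Let rade m : probability R R :=
  distribution (bernoulli_prob (2^-1 : R) : probability bool R) (@rade_entry R m).

(** The scale [m] of the entries is kept apart from their number [k], so that induction on [k]
    leaves the entry law alone. *)
Let ge0_integral_iid_rade m k (F : k.-tuple R -> \bar R) :
  measurable_fun setT F -> (forall x, 0 <= F x) ->
  \int[iid (rade m) k]_x F x = ((2^-1) ^+ k)%:E *
    \sum_(b : k.-tuple bool) F [tuple rade_entry R m (tnth b i) | i < k].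
Proof.
elim: k F => [F mF F0|k IH F mF F0].
  rewrite ge0_integral_iid0// expr0 mul1e (big_pred1 [tuple])/=.
    by congr F; apply: eq_from_tnth; case.
  by move=> b; apply/esym/eqP; exact: tuple0.
rewrite ge0_integral_iidS//.
have mFp : measurable_fun setT (F \o @pair_cons _ R k).
  by apply: (measurableT_comp mF); exact: measurable_pair_cons.
rewrite ge0_integral_distribution//; last 2 first.
- by apply: (@measurable_fun_fubini_tonelli_F _ _ _ _ _ _ (F \o @pair_cons _ R k)) => //=.
- by move=> x; exact: integral_ge0.
have h01 : (0 <= (2^-1 : R) <= 1)%R by apply/andP; split; lra.
rewrite integral_bernoulli_prob//; last by move=> b; exact: integral_ge0.
have EI c : \int[iid (rade m) k]_t F (pair_cons (rade_entry R m c, t)) =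
    ((2^-1) ^+ k)%:E * \sum_(b : k.-tuple bool)
      F (pair_cons (rade_entry R m c, [tuple rade_entry R m (tnth b i) | i < k])).
  apply: (IH (fun t => F (pair_cons (rade_entry R m c, t)))) => //.
  by apply: (measurableT_comp mFp); exact: measurable_pair1.
rewrite [X in _ * X + _]EI [X in _ + _ * X]EI.
rewrite (_ : unstable.onem (2^-1 : R) = 2^-1)%R; last by rewrite /unstable.onem; lra.
rewrite !muleA -!EFinM -exprS -ge0_muleDr; last 2 first.
- exact: sume_ge0.
- exact: sume_ge0.
congr (_ * _); rewrite big_tupleS big_bool/=.
have E a (b : k.-tuple bool) :
    pair_cons (rade_entry R m a, [tuple rade_entry R m (tnth b i) | i < k]) =
    [tuple rade_entry R m (tnth [tuple of a :: b] i) | i < k.+1].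
  apply: eq_from_tnth => i; rewrite tnth_mktuple /pair_cons.
  by case: (unliftP ord0 i) => [j|] ->; rewrite /= ?tnth0// !tnthS tnth_mktuple.
by congr (_ + _); apply: eq_bigr => b _; rewrite E.
Qed.

Lemma ge0_integral_rademacher n (F : vec R n -> \bar R) :
  measurable_fun setT F -> (forall x, 0 <= F x) ->
  \int[@rademacher R n]_x F x = ((2^-1) ^+ n)%:E * \sum_(b : n.-tuple bool) F (rade_vec b).
Proof. exact: ge0_integral_iid_rade. Qed.

End rademacher_integral.

(** * The spiked law as a tilt of the noise *)

Section spiked_integral.
Context {R : realType}.
Implicit Types (d n : nat) (lam : R).

(** A sum over multi-indices of a product over the [d] slots is a product of [d] sums, all equal to
    [dot x y]. *)
Lemma dot_tensor_pow d n (x y : vec R n) :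
  dot (tensor_pow d x) (tensor_pow d y) = dot x y ^+ d.
Proof.
rewrite /dot (reindex enum_rank)/=; last exact: onW_bij (enum_rank_bij _).
transitivity (\sum_(a : tindex d n) \prod_(k < d) (tnth x (a k) * tnth y (a k))).
  by apply: eq_bigr => a _; rewrite !tnth_mktuple enum_rankK big_split.
rewrite -(bigA_distr_bigA (fun (_ : 'I_d) i => tnth x i * tnth y i))/=.
by rewrite prodr_const card_ord.
Qed.

Definition signal lam d n (x : vec R n) : tensor R d n :=
  [tuple lam * tnth (tensor_pow d x) j | j < #|{: tindex d n}|].

Lemma dot_signalr lam d n (G : tensor R d n) (x : vec R n) :
  dot G (signal lam d x) = lam * dot G (tensor_pow d x).
Proof.
by rewrite /dot mulr_sumr; apply: eq_bigr => j _; rewrite tnth_mktuple mulrCA.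
Qed.

Lemma dot_signal lam mu d n (x y : vec R n) :
  dot (signal lam d x) (signal mu d y) = lam * mu * dot x y ^+ d.
Proof.
rewrite -dot_tensor_pow /dot mulr_sumr; apply: eq_bigr => j _.
by rewrite 2!(tnth_mktuple (fun j => _ * tnth _ j)) mulrACA.
Qed.

(** A tensor power is already symmetric, so planting it before or after symmetrization is the same.
    This reduces the spiked model to a shift of independent Gaussian entries. *)
Lemma spike_sym lam d n (x : vec R n) (G : tensor R d n) :
  spike lam (x, tensor_sym G) = tensor_sym (tshift G (signal lam d x)).
Proof.
have fact0 : (d`!%:R : R) != 0 by rewrite pnatr_eq0 -lt0n fact_gt0.
congr mktensor; apply/funext => a /=.
rewrite !tentry_mktensor.
under [in RHS]eq_bigr => s _ do rewrite /tentry !tnth_mktuple enum_rankK.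
rewrite big_split/= mulrDr addrC; congr (_ + _).
rewrite [X in _ = _ * X](eq_bigr (fun=> lam * \prod_(k < d) tnth x (a k)));
  last first => [s _|].
  congr (_ * _); rewrite [RHS](reindex_inj (@perm_inj _ s))/=.
  by apply: eq_bigr => k _; rewrite ffunE.
by rewrite sumr_const card_Sn -(mulr_natl (lam * _)) mulKf.
Qed.

Local Open Scope ereal_scope.

(* The noise before symmetrization: [WT R d n] is its image by [tensor_sym]. *)
Definition noise d n : probability (tensor R d n) R :=
  iid (centered_gaussian (2 / n%:R)) #|{: tindex d n}|.

Lemma ge0_integral_WT d n (F : tensor R d n -> \bar R) :
  measurable_fun setT F -> (forall T, 0 <= F T) ->
  \int[WT R d n]_T F T = \int[noise d n]_G F (tensor_sym G).
Proof. by move=> mF F0; rewrite [LHS]ge0_integral_distribution. Qed.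

(** For each sign pattern [b] the spiked tensor symmetrizes a shifted noise, and the shift formula
    trades the shift for a likelihood ratio. The test function may also see the signal, as recovery
    requires. *)
Lemma ge0_integral_spike lam d n (F : vec R n * tensor R d n -> \bar R) :
  (0 < n)%N -> measurable_fun setT F -> (forall z, 0 <= F z) ->
  \int[signal_noise d (@rademacher R) n]_z F (z.1, spike lam z) =
  ((2^-1) ^+ n)%:E * \sum_(b : n.-tuple bool)
    \int[noise d n]_G (F (rade_vec b, tensor_sym G) *
      (gauss_tilt (2 / n%:R) (signal lam d (rade_vec b)) G)%:E).
Proof.
move=> n0 mF F0.
pose H (z : vec R n * tensor R d n) := F (z.1, spike lam z).
have mH : measurable_fun setT H.
  by apply: (measurableT_comp mF); apply: measurable_fun_pair.
have mFx x : measurable_fun setT (fun T => F (x, T)).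
  by apply: (measurableT_comp mF); exact: measurable_pair1.
have H0 z : 0 <= H z by exact: F0.
apply: etrans (fubini_tonelli1 _ mH H0) _.
rewrite ge0_integral_rademacher; last 2 first.
- exact: measurable_fun_fubini_tonelli_F.
- by move=> x; exact: integral_ge0.
congr (_ * _); apply: eq_bigr => b _.
rewrite /fubini_F ge0_integral_WT; last 2 first.
- by apply: (measurableT_comp mH); exact: measurable_pair1.
- by move=> T; exact: H0.
have mFs : measurable_fun setT (fun G => F (rade_vec b, tensor_sym G)).
  by apply: (measurableT_comp (mFx _)); exact: measurable_tensor_sym.
have v0 : (0 < 2 / n%:R :> R)%R by rewrite divr_gt0// ltr0n.
rewrite -(iid_gaussian_shift _ v0 mFs)//.
by apply: eq_integral => G _; rewrite /H spike_sym.
Qed.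

End spiked_integral.

(** * The rate function and the threshold *)

Section entropy.
Context {R : realType}.
Implicit Types (p t y : R).

(** For y > 0 and [s] its square root, ln y = 2 ln s >= 2 (1 - 1/s), so the right side is at least 2
    s^2 - 2 s; this exceeds the left side by (s - 1)^2 (6 - (s + 1)^2) / 6. *)
Lemma mulr_ln_ge y : 0 <= y <= 2 -> y - 1 + (y - 1) ^+ 2 / 6 <= y * ln y.
Proof.
move=> /andP[]; rewrite le_eqVlt => /predU1P[<- _|y0 y2].
  by rewrite mul0r; lra.
have s0 : 0 < Num.sqrt y by rewrite sqrtr_gt0.
have yE : y = Num.sqrt y ^+ 2 by rewrite sqr_sqrtr// ltW.
move: (Num.sqrt y) s0 yE => s s0 yE; rewrite {}yE in y0 y2 *.
have lns : 1 - s^-1 <= ln s.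
  have := @le_ln1Dx R (s^-1 - 1); rewrite subrKC lnV ?posrE// => h.
  by rewrite -[leRHS]opprK lerNr opprB h// ltrBDl subrr invr_gt0.
have sV : s * s^-1 = 1 by rewrite divff// gt_eqF.
rewrite lnXn// -(mulr_natl (ln s)).
have h : s ^+ 2 * (2 * (1 - s^-1)) <= s ^+ 2 * (2 * ln s) by rewrite ler_pM2l// ler_pM2l.
apply: le_trans h.
have -> : s ^+ 2 * (2 * (1 - s^-1)) = 2 * s ^+ 2 - 2 * s * (s * s^-1) by ring.
rewrite sV.
(* Together with s^2 <= 2 this gives (s + 1)^2 <= 6. *)
have s32 : s <= 3 / 2 by nra.
have : 0 <= (s - 1) ^+ 2 * (6 - (s + 1) ^+ 2) by rewrite mulr_ge0 ?sqr_ge0//; nra.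
by lra.
Qed.

Lemma mulr_ln2 p : 0 <= p -> p * ln (2 * p) = p * ln 2 + p * ln p.
Proof.
rewrite le_eqVlt => /predU1P[<-|p0]; first by rewrite !mul0r addr0.
by rewrite lnM ?posrE// mulrDr.
Qed.

Lemma f_radeE t : -1 <= t <= 1 ->
  f_rade t = ((1 + t) * ln (1 + t) + (1 - t) * ln (1 - t)) / 2.
Proof.
move=> /andP[t1 t2]; rewrite /f_rade /binary_entropy.
have := @mulr_ln2 ((1 + t) / 2); have := @mulr_ln2 ((1 - t) / 2).
rewrite !(mulrC 2) !divfK// => h1 h2.
have -> : 1 - (1 + t) / 2 = (1 - t) / 2 by lra.
have {}h1 : (1 - t) / 2 * ln (1 - t) =
    (1 - t) / 2 * ln 2 + (1 - t) / 2 * ln ((1 - t) / 2) by apply: h1; lra.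
have {}h2 : (1 + t) / 2 * ln (1 + t) =
    (1 + t) / 2 * ln 2 + (1 + t) / 2 * ln ((1 + t) / 2) by apply: h2; lra.
by lra.
Qed.

(** In the sum of the bounds at 1 + t and 1 - t the linear terms cancel. *)
Lemma f_rade_ge t : -1 <= t <= 1 -> t ^+ 2 / 6 <= f_rade t.
Proof.
move=> t1; rewrite f_radeE//; case/andP: t1 => t1 t2.
have : 1 + t - 1 + (1 + t - 1) ^+ 2 / 6 <= (1 + t) * ln (1 + t) by apply: mulr_ln_ge; lra.
have : 1 - t - 1 + (1 - t - 1) ^+ 2 / 6 <= (1 - t) * ln (1 - t) by apply: mulr_ln_ge; lra.
by lra.
Qed.

Lemma f_rade_abs t : -1 <= t <= 1 -> f_rade `|t| = f_rade t.
Proof.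
move=> t1; have [t0|t0] := leP 0 t; first by rewrite ger0_norm.
by rewrite ltr0_norm// !f_radeE ?opprK 1?[in LHS]addrC//; lra.
Qed.

Lemma f_rade_le t : -1 <= t <= 1 -> f_rade t <= ln 2.
Proof.
move=> /andP[t1 t2].
have ml p : 0 <= p <= 1 -> p * ln p <= 0.
  by move=> /andP[p0 p1]; rewrite mulr_ge0_le0// ln_le0.
have := ml ((1 + t) / 2); have := ml (1 - (1 + t) / 2).
rewrite /f_rade /binary_entropy => h1 h2.
have {}h1 : (1 - (1 + t) / 2) * ln (1 - (1 + t) / 2) <= 0 by apply: h1; lra.
have {}h2 : ((1 + t) / 2) * ln ((1 + t) / 2) <= 0 by apply: h2; lra.
by lra.
Qed.

Lemma f_rade1 : f_rade (1 : R) = ln 2.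
Proof. by rewrite f_radeE ?subrr ?mul0r ?addr0; lra. Qed.

Lemma bernoulli_onem (x : R) d : 0 <= x <= 1 -> 1 - d%:R * x <= (1 - x) ^+ d.
Proof.
move=> /andP[x0 x1]; elim: d => [|d IH]; first by rewrite mul0r subr0 expr0.
have d0 : (0 : R) <= d%:R by [].
rewrite exprS -natr1.
have : (1 - x) * (1 - d%:R * x) <= (1 - x) * (1 - x) ^+ d by rewrite ler_wpM2l// subr_ge0.
by apply: le_trans; nra.
Qed.

(** Pick an admissible [l] strictly above [lam]; the gap between lam^2 and l^2 pays both for the
    truncation margin [eta] and for a factor c < 1, which leaves exponential room in the second
    moment. *)
Lemma lambda_rade_slack d (lam : R) : (0 < d)%N ->
  0 <= lam -> lam < lambda_rade R d ->
  exists eta c : R, [/\ 0 < eta, 0 <= c < 1 & forall t, -1 <= t <= 1 ->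
    (lam ^+ 2 / 2 + lam * eta) * (`|t| ^+ d / (1 + `|t| ^+ d)) <= c * f_rade t].
Proof.
move=> d0 lam0 lamd.
have [l [Sl laml]] : exists l, (forall t, 0 <= t < 1 ->
    l ^+ 2 / 2 * (t ^+ d / (1 + t ^+ d)) <= f_rade t) /\ lam < l.
  have [S0|S0] := pselect (exists l, [set l : R | forall t : R, 0 <= t < 1 ->
         l ^+ 2 / 2 * (t ^+ d / (1 + t ^+ d)) <= f_rade t] l /\ lam < l).
    by case: S0 => l [Sl laml]; exists l.
  have lam_ub : ubound [set l : R | forall t : R, 0 <= t < 1 ->
         l ^+ 2 / 2 * (t ^+ d / (1 + t ^+ d)) <= f_rade t] lam.
    by move=> l Sl; rewrite leNgt; apply/negP => ll; apply: S0; exists l.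
  suff : lambda_rade R d <= lam by rewrite leNgt lamd.
  have [SN0|S_0] := pselect (nonempty [set l : R | forall t : R, 0 <= t < 1 ->
         l ^+ 2 / 2 * (t ^+ d / (1 + t ^+ d)) <= f_rade t]).
    exact: ge_sup.
  (* The supremum of the empty set is 0 by convention, which is at most [lam]. *)
  by rewrite /lambda_rade sup_out// => -[].
have l0 : 0 < l by lra.
have ln20 : 0 < ln 2 :> R by rewrite ln_gt0//; lra.
(* The constraint at the excluded endpoint t = 1, where t^d / (1 + t^d) = 1/2 and f = ln 2. *)
have l1 : l ^+ 2 / 4 <= ln 2.
  rewrite leNgt; apply/negP => ll.
  pose e : R := ln 2; pose a := l ^+ 2 / 2 - e.
  have ae : e < a by rewrite /a /e; lra.
  have a0 : 0 < a by rewrite (lt_trans _ ae).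
  (* Admissibility and f <= e force a t^d <= e. By Bernoulli's inequality, t = 1 - x has t^d at
     least the midpoint of e/a and 1, a contradiction without passing to the limit. *)
  pose x := (1 - e / a) / (2 * d%:R).
  have dR : (1 : R) <= d%:R by rewrite ler1n.
  have ea : 0 < 1 - e / a < 1.
    by rewrite subr_gt0 ltr_pdivrMr// mul1r ae ltrBlDr ltrDl divr_gt0.
  have xd : d%:R * x = (1 - e / a) / 2 by rewrite /x; field; rewrite gt_eqF//; lra.
  have x0 : 0 < x by rewrite /x divr_gt0//; lra.
  have x1 : x < 1 by nra.
  have := Sl (1 - x); have := @bernoulli_onem x d.
  rewrite xd => h1 h2.
  have {}h1 : 1 - (1 - e / a) / 2 <= (1 - x) ^+ d by apply: h1; lra.
  have {}h2 : l ^+ 2 / 2 * ((1 - x) ^+ d / (1 + (1 - x) ^+ d)) <= e.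
    apply: (le_trans (h2 _)); first lra.
    by apply: f_rade_le; lra.
  move: ((1 - x) ^+ d) h1 h2 => y h1.
  have y0 : 0 < 1 + y by lra.
  rewrite mulrA ler_pdivrMr// => h2.
  have : a * y <= e by rewrite /a; lra.
  rewrite -ler_pdivlMl// mulrC => ye.
  by lra.
(* This [eta] makes lam eta <= (l^2 - lam^2) / 4, so that lam^2/2 + lam eta <= (lam^2 + l^2) / 4 = c
   l^2 / 2; the [+ 1] keeps the denominator positive at lam = 0. *)
exists ((l ^+ 2 - lam ^+ 2) / (4 * (lam + 1))), ((lam ^+ 2 / l ^+ 2 + 1) / 2).
have l2 : 0 < l ^+ 2 by rewrite exprn_gt0.
have lam2 : lam ^+ 2 < l ^+ 2 by rewrite ltr_pXn2r// nnegrE; lra.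
have q1 : 0 <= lam ^+ 2 / l ^+ 2 < 1.
  by rewrite divr_ge0 ?sqr_ge0//= ltr_pdivrMr// mul1r.
split; [by rewrite divr_gt0//; lra|lra|].
move=> t t1; set K := _ + _; set c := _ / 2.
have Kc : K <= c * (l ^+ 2 / 2).
  have -> : c * (l ^+ 2 / 2) = (lam ^+ 2 + l ^+ 2) / 4 by rewrite /c; field; rewrite gt_eqF.
  rewrite /K mulrA.
  suff : lam * (l ^+ 2 - lam ^+ 2) / (4 * (lam + 1)) <= (l ^+ 2 - lam ^+ 2) / 4 by lra.
  by rewrite ler_pdivrMr ?mulr_gt0//; [nra|lra].
have r0 : 0 <= `|t| ^+ d by rewrite exprn_ge0.
apply: (@le_trans _ _ (c * (l ^+ 2 / 2) * (`|t| ^+ d / (1 + `|t| ^+ d)))).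
  by rewrite ler_wpM2r// divr_ge0// addr_ge0.
rewrite -mulrA ler_wpM2l//; first by rewrite /c; lra.
rewrite -f_rade_abs//.
have [->|tn1] := eqVneq `|t| 1.
  by rewrite expr1n div1r f_rade1 (_ : 1 + 1 = 2 :> R)//; lra.
by apply: Sl; rewrite normr_ge0 lt_neqAle tn1/= ler_norml.
Qed.

End entropy.

(** * Large deviations of the overlap *)

Section overlap.
Context {R : realType}.

Definition agree n (b b' : n.-tuple bool) : nat := (\sum_(i < n) (tnth b i == tnth b' i))%N.

(** The inner product of two points of the prior's support whose signs agree in [k] of the [n]
    places. *)
Definition overlap n (k : nat) : R := 2 * k%:R / n%:R - 1.

Lemma agree_le n (b b' : n.-tuple bool) : (agree b b' <= n)%N.
Proof.
rewrite -[leqRHS]card_ord -sum1_card; apply: leq_sum => i _; exact: leq_b1.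
Qed.

Lemma agreexx n (b : n.-tuple bool) : agree b b = n.
Proof.
by rewrite /agree (eq_bigr (fun=> 1%N)) ?sum1_card ?card_ord// => i _; rewrite eqxx.
Qed.

Lemma overlap_itv n k : (0 < n)%N -> (k <= n)%N -> -1 <= overlap n k <= 1.
Proof.
move=> n0 kn; have nR : (0 : R) < n%:R by rewrite ltr0n.
have kR : k%:R <= n%:R :> R by rewrite ler_nat.
have : k%:R / n%:R <= 1 :> R by rewrite ler_pdivrMr// mul1r.
have : 0 <= k%:R / n%:R :> R by rewrite divr_ge0// ltW.
by rewrite /overlap; lra.
Qed.

Lemma dot_rade_vec n (b b' : n.-tuple bool) : (0 < n)%N ->
  dot (rade_vec b) (rade_vec b') = overlap n (agree b b').
Proof.
move=> n0; have nR : (n%:R : R) != 0 by rewrite pnatr_eq0 -lt0n.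
have sq : Num.sqrt n%:R * Num.sqrt n%:R = n%:R :> R by rewrite -expr2 sqr_sqrtr.
have E c c' : rade_entry R n c * rade_entry R n c' = (2 * (c == c')%:R - 1) / n%:R.
  rewrite /rade_entry mulrACA -invfM sq; congr (_ / _).
  by case: c c' => [] [] /=; ring.
rewrite /dot (eq_bigr (fun i => (2 * (tnth b i == tnth b' i)%:R - 1) / n%:R)); last first.
  by move=> i _; rewrite !tnth_mktuple E.
rewrite -mulr_suml sumrB -mulr_sumr -natr_sum sumr_const card_ord /overlap.
by rewrite mulrBl divff.
Qed.

(** The second hypothesis admits the corner 0^0 = 1, met below when k/n is 0 or 1; [ln 0] is then
    multiplied by 0. *)
Lemma exprn_expR (x : R) k : 0 <= x -> (x = 0 -> k = 0%N) -> x ^+ k = expR (k%:R * ln x).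
Proof.
rewrite le_eqVlt => /predU1P[<- /(_ erefl) ->|x0 _].
  by rewrite mul0r expR0 expr0.
by rewrite expRM_natl lnK// posrE.
Qed.

(* The sign patterns agreeing with [b] in exactly [k] places all have the same
   weight under the product of Bernoulli laws with parameter [k / n]. *)
Lemma overlap_prob n k (b : n.-tuple bool) : (0 < n)%N -> (k <= n)%N ->
  (2^-1) ^+ n * #|[pred b' | agree b b' == k]|%:R <= expR (- (n%:R * f_rade (overlap n k))).
Proof.
move=> n0 kn; have nR : (0 : R) < n%:R by rewrite ltr0n.
have kR : k%:R <= n%:R :> R by rewrite ler_nat.
pose p : R := k%:R / n%:R.
have p0 : 0 <= p by rewrite /p divr_ge0// ltW.
have p1 : p <= 1 by rewrite /p ler_pdivrMr// mul1r.
have np : n%:R * p = k%:R by rewrite /p mulrC divfK// gt_eqF.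
pose w (b' : n.-tuple bool) : R := \prod_(i < n) (if tnth b i == tnth b' i then p else 1 - p).
have w0 b' : 0 <= w b' by apply: prodr_ge0 => i _; case: ifP => _; lra.
have sumw : \sum_b' w b' = 1.
  rewrite (sum_tuple_prod (fun i c => if tnth b i == c then p else 1 - p)).
  by rewrite big1// => i _; rewrite big_bool; case: (tnth b i) => /=; lra.
(* k ln p + (n - k) ln (1 - p) = - n H(p), with p = k/n. *)
have wE b' : agree b b' = k -> w b' = expR (n%:R * (f_rade (overlap n k) - ln 2)).
  move=> abk.
  have -> : w b' = p ^+ k * (1 - p) ^+ (n - k).
    rewrite -abk /w (eq_bigr (fun i => p ^+ (tnth b i == tnth b' i) *
      (1 - p) ^+ (tnth b i != tnth b' i))); last first.
      by move=> i _; case: eqP => _; rewrite ?expr0 ?expr1 ?mul1r ?mulr1.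
    rewrite big_split/= !prodrXr; congr (_ * _ ^+ _).
    rewrite -[X in (X - _)%N]card_ord -sum1_card -sumnB; last by move=> i _; exact: leq_b1.
    by apply: eq_bigr => i _; case: eqP.
  have -> : p ^+ k = expR (k%:R * ln p).
    by apply: exprn_expR => // p00; apply/eqP; rewrite -(pnatr_eq0 R) -np p00 mulr0.
  have -> : (1 - p) ^+ (n - k) = expR ((n - k)%:R * ln (1 - p)).
    apply: exprn_expR; first by rewrite subr_ge0.
    move=> /eqP; rewrite subr_eq0 => /eqP p1'.
    by apply/eqP; rewrite subn_eq0 -(ler_nat R) -np -p1' mulr1.
  rewrite -expRD.
  congr expR; rewrite /f_rade /binary_entropy.
  have -> : (1 + overlap n k) / 2 = p by rewrite /overlap /p; field; rewrite gt_eqF.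
  by rewrite natrB// -np; ring.
have c2 : #|[pred b' | agree b b' == k]|%:R * expR (n%:R * (f_rade (overlap n k) - ln 2)) <= 1.
  apply: le_trans (_ : \sum_b' w b' <= 1); last by rewrite sumw.
  rewrite (bigID (fun b' => agree b b' == k))/= ler_wpDr ?sumr_ge0//.
  rewrite mulr_natl -sumr_const le_eqVlt; apply/orP; left; apply/eqP.
  by apply: eq_bigr => b' /eqP /wE.
have -> : (2^-1) ^+ n = expR (- (n%:R * ln 2)) :> R.
  by rewrite exprn_expR ?lnV ?posrE// ?mulrN// => /eqP; rewrite invr_eq0 pnatr_eq0.
rewrite mulrC -(@ler_pM2r _ (expR (n%:R * f_rade (overlap n k)))) ?expR_gt0//.
rewrite -mulrA -!expRD addNr expR0; apply: le_trans c2.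
by rewrite (mulrBr _ (f_rade _)) [leLHS]mulrC [leRHS]mulrC addrC.
Qed.

(** Split at |t| <= delta. Near overlaps: the exponent is at most n K |t|^3 because d >= 3, and w <=
    omega. Far ones: w <= 1, the exponent is at most c n f(t), and each of the n + 1 agreement
    counts has probability at most exp (- n f(t)), with f(t) >= delta^2 / 6. The weight is 1 for
    detection and |t|^d for recovery. *)
Lemma second_moment_bound n d (b : n.-tuple bool) (K c delta omega : R) (w : R -> R) :
  (0 < n)%N -> (3 <= d)%N -> 0 <= K -> 0 <= c < 1 -> 0 <= delta <= 1 -> 0 <= omega ->
  (forall t, -1 <= t <= 1 -> K * (`|t| ^+ d / (1 + `|t| ^+ d)) <= c * f_rade t) ->
  (forall t, -1 <= t <= 1 -> 0 <= w t <= 1) ->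
  (forall t, `|t| <= delta -> w t <= omega) ->
  (2^-1) ^+ n * \sum_(b' : n.-tuple bool)
    (let t := overlap n (agree b b') in
     w t * expR (n%:R * K * (`|t| ^+ d / (1 + `|t| ^+ d)))) <=
  omega * expR (n%:R * K * delta ^+ 3) +
  n.+1%:R * expR (- (n%:R * (1 - c) * delta ^+ 2 / 6)).
Proof.
move=> n0 d3 K0 /andP[c0 c1] /andP[de0 de1] om0 HK w01 wom.
have nR : (0 : R) < n%:R by rewrite ltr0n.
pose M t := w t * expR (n%:R * K * (`|t| ^+ d / (1 + `|t| ^+ d))).
pose B t : R := if `|t| <= delta then 0 else expR (n%:R * (c * f_rade t)).
have Mle t : -1 <= t <= 1 -> M t <= omega * expR (n%:R * K * delta ^+ 3) + B t.
  move=> t1; have /andP[wt0 wt1] := w01 _ t1.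
  have r0 : 0 <= `|t| ^+ d by rewrite exprn_ge0.
  rewrite /M /B; case: ifPn => [td|_].
    rewrite addr0; apply: ler_pM; rewrite ?expR_ge0 ?wom//.
    rewrite ler_expR ler_wpM2l// ?mulr_ge0// ?(ltW nR)//.
    rewrite ler_pdivrMr ?ltr_wpDr//.
    apply: (@le_trans _ _ (delta ^+ 3)); last by rewrite ler_peMr ?exprn_ge0// lerDl.
    apply: (@le_trans _ _ (`|t| ^+ 3)).
      by rewrite ler_wiXn2l// (le_trans td).
    by rewrite lerXn2r// nnegrE.
  rewrite ler_wpDl ?mulr_ge0 ?expR_ge0//.
  apply: (@le_trans _ _ (expR (n%:R * K * (`|t| ^+ d / (1 + `|t| ^+ d))))).
    by rewrite ler_piMl ?expR_ge0.
  by rewrite ler_expR -mulrA ler_wpM2l ?(ltW nR)// HK.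
have ov b' : -1 <= overlap n (agree b b') <= 1 by apply: overlap_itv => //; exact: agree_le.
apply: (@le_trans _ _ ((2^-1) ^+ n * \sum_(b' : n.-tuple bool)
    (omega * expR (n%:R * K * delta ^+ 3) + B (overlap n (agree b b'))))).
  by rewrite ler_wpM2l ?exprn_ge0 ?invr_ge0//; apply: ler_sum => b' _; exact: Mle.
rewrite big_split/= sumr_const card_tuple card_bool mulrDr; apply: lerD.
  by rewrite -(mulr_natr (omega * _)) natrX mulrCA -exprMn mulVf ?expr1n ?mulr1.
rewrite (partition_big (fun b' => inord (agree b b') : 'I_n.+1) xpredT)//=.
rewrite mulr_sumr -[n.+1 in leRHS]card_ord -sum1_card natr_sum mulr_suml.
apply: ler_sum => k _; rewrite mul1r.
rewrite (eq_bigl (fun b' => agree b b' == k)); last first.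
  move=> b'; apply/eqP/eqP => [<-|->]; last by rewrite inord_val.
  by rewrite inordK// ltnS agree_le.
rewrite (eq_bigr (fun=> B (overlap n k))) => [|b' /eqP ->//].
rewrite sumr_const -(mulr_natl (B _)) mulrA.
have kn : (k <= n)%N by rewrite -ltnS.
have Bk0 : 0 <= B (overlap n k) by rewrite /B; case: ifP => // _; exact: expR_ge0.
apply: (le_trans (ler_wpM2r Bk0 (overlap_prob b n0 kn))).
rewrite /B; case: ifPn => [_|]; first by rewrite mulr0 expR_ge0.
rewrite -ltNge => td; rewrite -expRD ler_expR.
have f6 := f_rade_ge (overlap_itv n0 kn).
have d2 : delta ^+ 2 <= overlap n k ^+ 2.
  by rewrite -(real_normK (num_real (overlap n k))) lerXn2r// ?nnegrE// ltW.
have : 0 <= n%:R * ((1 - c) * (f_rade (overlap n k) - delta ^+ 2 / 6)).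
  by rewrite mulr_ge0 ?(ltW nR)// mulr_ge0//; lra.
by lra.
Qed.

End overlap.

(** * Truncated likelihood ratios *)

Lemma le_EFin_decomp (R : realType) (x : \bar R) (r : R) :
  (0 <= x)%E -> (x <= r%:E)%E ->
  exists2 y : R, x = y%:E & 0 <= y <= r.
Proof.
case: x => [y| |]//; rewrite ?leye_eq// !lee_fin => y0 yr.
by exists y => //; rewrite y0.
Qed.

Section ge0_integral_EFin.
Local Open Scope ereal_scope.
Context d (T : measurableType d) (R : realType) (mu : {measure set T -> \bar R}).
Implicit Types f g : T -> R.

Lemma ge0_le_integral_EFin f g :
  measurable_fun setT f -> measurable_fun setT g ->
  (forall x, 0 <= f x)%R -> (forall x, f x <= g x)%R ->
  \int[mu]_x (f x)%:E <= \int[mu]_x (g x)%:E.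
Proof.
move=> mf mg f0 fg.
by apply: ge0_le_integral => //; try exact/measurable_EFinP;
  move=> x _; rewrite lee_fin.
Qed.

Lemma ge0_integralZl_EFinM (k : R) f :
  measurable_fun setT f -> (forall x, 0 <= f x)%R -> (0 <= k)%R ->
  \int[mu]_x (k * f x)%:E = k%:E * \int[mu]_x (f x)%:E.
Proof.
move=> mf f0 k0; under eq_integral do rewrite EFinM.
apply: ge0_integralZl_EFin => //; first by move=> x _; rewrite lee_fin.
exact/measurable_EFinP.
Qed.

Lemma ge0_integralD_EFin f g :
  measurable_fun setT f -> measurable_fun setT g ->
  (forall x, 0 <= f x)%R -> (forall x, 0 <= g x)%R ->
  \int[mu]_x (f x + g x)%:E = \int[mu]_x (f x)%:E + \int[mu]_x (g x)%:E.
Proof.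
move=> mf mg f0 g0; under eq_integral do rewrite EFinD.
apply: ge0_integralD => //; try exact/measurable_EFinP.
- by move=> x _; rewrite lee_fin.
- by move=> x _; rewrite lee_fin.
Qed.

Lemma ge0_integral_sum_EFin (I : finType) (f : I -> T -> R) :
  (forall i, measurable_fun setT (f i)) -> (forall i x, 0 <= f i x)%R ->
  \int[mu]_x (\sum_i f i x)%:E = \sum_i \int[mu]_x (f i x)%:E.
Proof.
move=> mf f0; under eq_integral do rewrite -sumEFin.
rewrite ge0_integral_sum// => [i|i x _]; last by rewrite lee_fin.
exact/measurable_EFinP.
Qed.

End ge0_integral_EFin.

Section truncated_likelihood.
Context {R : realType} (d n : nat) (n_gt0 : (0 < n)%N).
Implicit Types (lam eta : R) (x y : vec R n) (G : tensor R d n).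

Let v : R := 2 / n%:R.

Let v_gt0 : 0 < v. Proof. by rewrite divr_gt0// ltr0n. Qed.

Let n_gt0R : (0 : R) < n%:R. Proof. by rewrite ltr0n. Qed.

(** Likelihood ratio at the level of the unsymmetrized noise [G]. *)
Definition lik lam x G : R := gauss_tilt (2 / n%:R) (signal lam d x) G.

Definition typical lam eta x : set (tensor R d n) :=
  [set G | dot G (tensor_pow d x) <= lam + eta].

Definition tlik lam eta x G : R := lik lam x G * \1_(typical lam eta x) G.

Lemma lik_ge0 lam x G : 0 <= lik lam x G.
Proof. exact: expR_ge0. Qed.

Lemma tlik_ge0 lam eta x G : 0 <= tlik lam eta x G.
Proof. by rewrite mulr_ge0 ?lik_ge0. Qed.

Lemma measurable_lik lam x : measurable_fun setT (lik lam x).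
Proof. exact: measurable_gauss_tilt. Qed.

Lemma measurable_typical lam eta x : measurable (typical lam eta x).
Proof.
have /(_ measurableT `]-oo, lam + eta]%classic) :=
  @measurable_dot R _ (tensor_pow d x).
rewrite setTI; move/(_ (measurable_itv _)).
by congr measurable; apply/seteqP; split => G /=; rewrite in_itv.
Qed.

Lemma measurable_tlik lam eta x : measurable_fun setT (tlik lam eta x).
Proof.
apply: measurable_funM; first exact: measurable_lik.
by apply: measurable_indic; exact: measurable_typical.
Qed.

Lemma likE lam x G : dot x x = 1 ->
  lik lam x G = expR (n%:R / 2 * (lam * dot G (tensor_pow d x) - lam ^+ 2 / 2)).
Proof.
move=> x1; rewrite /lik /gauss_tilt dot_signalr dot_signal x1 expr1n mulr1 -expr2.
by congr expR; field; rewrite gt_eqF.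
Qed.

Local Open Scope ereal_scope.

Lemma integral_lik lam x : \int[noise d n]_G (lik lam x G)%:E = 1.
Proof. exact: integral_gauss_tilt. Qed.

(** Chernoff bound by a stronger spike: beyond lam + eta, the ratio at [lam] is at most exp (- n
    eta^2 / 4) times the ratio at [lam + eta], whose integral is 1. *)
Lemma integral_lik_atypical lam eta x : dot x x = 1%R -> (0 <= eta)%R ->
  \int[noise d n]_G (lik lam x G * \1_(~` typical lam eta x) G)%:E <=
  (expR (- (n%:R * eta ^+ 2 / 4)))%:E.
Proof.
move=> x1 eta0.
rewrite -[leRHS]mule1 -(integral_lik (lam + eta) x) -ge0_integralZl_EFinM; last 3 first.
- exact: measurable_lik.
- exact: lik_ge0.
- exact: expR_ge0.
apply: ge0_le_integral_EFin.
- apply: measurable_funM; first exact: measurable_lik.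
  by apply: measurable_indic; apply: measurableC; exact: measurable_typical.
- by apply: measurable_funM => //; exact: measurable_lik.
- by move=> G; rewrite mulr_ge0 ?lik_ge0.
move=> G; rewrite indicE.
case: (boolP (G \in _)) => [|_]; last by rewrite mulr0 mulr_ge0 ?expR_ge0.
rewrite inE/= => /negP; rewrite -ltNge => gx.
rewrite mulr1 !likE// -expRD ler_expR.
set g := dot _ _ in gx *.
have : (0 <= n%:R / 2 * (eta * (g - (lam + eta))))%R.
  by rewrite mulr_ge0 ?divr_ge0 ?(ltW n_gt0R)// mulr_ge0// subr_ge0 ltW.
by lra.
Qed.

Lemma integral_tlik_le1 lam eta x : \int[noise d n]_G (tlik lam eta x G)%:E <= 1.
Proof.
rewrite -(integral_lik lam x); apply: ge0_le_integral_EFin.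
- exact: measurable_tlik.
- exact: measurable_lik.
- exact: tlik_ge0.
move=> G; rewrite ler_piMr ?lik_ge0// indicE; exact: lern1_bool.
Qed.

Lemma integral_tlik_ge lam eta x : dot x x = 1%R -> (0 <= eta)%R ->
  1 - (expR (- (n%:R * eta ^+ 2 / 4)))%:E <= \int[noise d n]_G (tlik lam eta x G)%:E.
Proof.
move=> x1 eta0; rewrite leeBlDr//.
apply: le_trans (leeD2l _ (integral_lik_atypical lam x1 eta0)).
rewrite -(integral_lik lam x) -ge0_integralD_EFin; last 4 first.
- exact: measurable_tlik.
- apply: measurable_funM; first exact: measurable_lik.
  by apply: measurable_indic; apply: measurableC; exact: measurable_typical.
- exact: tlik_ge0.
- by move=> G; rewrite mulr_ge0 ?lik_ge0.
rewrite le_eqVlt; apply/orP; left; apply/eqP; apply: eq_integral => G _.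
by rewrite -mulrDr !indicE in_setC; case: (G \in _); rewrite ?addr0 ?add0r mulr1.
Qed.

(* On the two truncation events, [1 <= exp (n/2 beta (2 (lam + eta) - g_x - g_y))];
   [beta = lam r/(1+r)] minimizes the resulting Gaussian moment. *)
Lemma integral_tlik2 lam eta x y : dot x x = 1%R -> dot y y = 1%R ->
  (0 <= lam)%R ->
  let r := (`|dot x y| ^+ d)%R in
  \int[noise d n]_G (tlik lam eta x G * tlik lam eta y G)%:E <=
  (expR (n%:R * (lam ^+ 2 / 2 + lam * eta) * (r / (1 + r))))%:E.
Proof.
move=> x1 y1 lam0 /=; set r := (`|dot x y| ^+ d)%R.
have r0 : (0 <= r)%R by rewrite exprn_ge0.
pose q : R := (r / (1 + r))%R.
have q0 : (0 <= q)%R by rewrite divr_ge0// addr_ge0.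
have q1 : ((1 - q) * (1 + r) = 1)%R by rewrite /q; field; lra.
pose be : R := (lam * q)%R.
(* The product of the two ratios and the inserted factor is, up to a constant, the density of the
   noise shifted by [u], whose integral is 1. *)
pose u : tensor R d n := tshift (signal (lam - be) d x) (signal (lam - be) d y).
pose gx G := dot G (tensor_pow d x); pose gy G := dot G (tensor_pow d y).
have dotu G : dot G u = ((lam - be) * (gx G + gy G))%R.
  rewrite mulrDr -!dot_signalr /dot -big_split/=; apply: eq_bigr => j _.
  by rewrite [tnth u j]tnth_mktuple mulrDr.
have dotC N (s t : vec R N) : dot s t = dot t s.
  by apply: eq_bigr => j _; rewrite mulrC.
have dotuu : dot u u = ((lam - be) ^+ 2 * (2 + 2 * dot x y ^+ d))%R.
  rewrite dotu /gx /gy !(dotC _ u).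
  have E z : dot (tensor_pow d z) u = ((lam - be) * (dot z x ^+ d + dot z y ^+ d))%R.
    by rewrite dotu /gx /gy !dot_tensor_pow.
  by rewrite !E x1 y1 (dotC _ y) !expr1n; ring.
have rho : (dot x y ^+ d <= r)%R by rewrite /r -normrX ler_norm.
(* The constant left by completing the square: |u|^2 / (2 v) = n (lam - be)^2 (1 + <x, y>^d) / 2,
   plus n be (lam + eta) from the inserted factor, minus n lam^2 / 4 from each ratio. *)
pose C : R := expR (n%:R *
  ((lam - be) ^+ 2 * (1 + dot x y ^+ d) / 2 + be * (lam + eta) - lam ^+ 2 / 2)).
apply: (@le_trans _ _ C%:E); last first.
  rewrite lee_fin ler_expR -[leRHS]mulrA ler_wpM2l ?(ltW n_gt0R)// -/q.
  (* Since lam - be = lam (1 - q) and (1 - q) (1 + r) = 1, one factor 1 - q cancels against 1 +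
     r. *)
  have : ((lam - be) ^+ 2 * (1 + dot x y ^+ d) <= lam ^+ 2 * (1 - q))%R.
    apply: (@le_trans _ _ ((lam - be) ^+ 2 * (1 + r))%R).
      by rewrite ler_wpM2l ?sqr_ge0// lerD2l.
    rewrite (_ : (lam - be) ^+ 2 * (1 + r) = lam ^+ 2 * (1 - q) * ((1 - q) * (1 + r)))%R.
      by rewrite q1 mulr1.
    by rewrite /be; ring.
  by rewrite /be; lra.
rewrite -[leRHS]mule1 -(@integral_gauss_tilt _ v _ u v_gt0) -ge0_integralZl_EFinM; last 3 first.
- exact: measurable_gauss_tilt.
- exact: gauss_tilt_ge0.
- exact: expR_ge0.
apply: ge0_le_integral_EFin.
- by apply: measurable_funM; exact: measurable_tlik.
- by apply: measurable_funM => //; exact: measurable_gauss_tilt.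
- by move=> G; rewrite mulr_ge0 ?tlik_ge0.
move=> G; rewrite /tlik !indicE.
case: (boolP (G \in typical lam eta x)) => [|_]; last first.
  by rewrite mulr0 mul0r mulr_ge0 ?expR_ge0.
case: (boolP (G \in typical lam eta y)) => [|_]; last first.
  by rewrite !mulr0 mulr_ge0 ?expR_ge0.
rewrite !inE /typical/= -/(gx G) -/(gy G) => hy hx.
rewrite !mulr1 !likE// -expRD /gauss_tilt -expRD ler_expR.
rewrite dotu dotuu -/(gx G) -/(gy G).
have be0 : (0 <= be)%R by rewrite mulr_ge0.
have : (0 <= n%:R / 2 * (be * ((lam + eta - gx G) + (lam + eta - gy G))))%R.
  by rewrite mulr_ge0 ?divr_ge0 ?(ltW n_gt0R)// mulr_ge0// addr_ge0// subr_ge0.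
have -> z : (z / v = n%:R / 2 * z)%R by rewrite /v; field; rewrite gt_eqF.
by lra.
Qed.

End truncated_likelihood.

Section dot_bounds.
Context {R : realType}.

(** Cauchy-Schwarz for unit vectors, by summing (s z_i - w_i)^2 >= 0 over [i] for both signs [s]. *)
Lemma dot_le1 n (x y : vec R n) : dot x x = 1 -> dot y y = 1 -> `|dot x y| <= 1.
Proof.
have h (z w : vec R n) : dot z z = 1 -> dot w w = 1 -> forall s : R, s ^+ 2 = 1 ->
    s * dot z w <= 1.
  move=> z1 w1 s s1.
  have -> : 1 = (dot z z + dot w w) / 2 by rewrite z1 w1; lra.
  rewrite /dot -big_split/= mulr_suml mulr_sumr; apply: ler_sum => i _.
  have := sqr_ge0 (s * tnth z i - tnth w i); rewrite sqrrB exprMn s1.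
  by lra.
move=> x1 y1; rewrite ler_norml.
have := h x y x1 y1 1 (expr1n _ _); have := h x y x1 y1 (-1).
rewrite sqrrN expr1n => /(_ erefl); lra.
Qed.

Lemma dot_rade_vecxx n (b : n.-tuple bool) : (0 < n)%N -> dot (rade_vec b) (rade_vec b) = 1 :> R.
Proof.
move=> n0; rewrite dot_rade_vec// agreexx /overlap -mulrA divff ?pnatr_eq0 -?lt0n//.
by lra.
Qed.

End dot_bounds.

(** * Averages over the prior and over pairs of spikes *)

Section averaged_likelihood.
Context {R : realType} (d n : nat) (n_gt0 : (0 < n)%N).
Variables (lam eta : R).
Hypotheses (lam_ge0 : 0 <= lam) (eta_ge0 : 0 <= eta).
Implicit Types (G : tensor R d n) (w : R -> R).

(** Expectation over the prior, as a sum over its 2^n equally likely sign patterns. *)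
Definition avg (f : n.-tuple bool -> R) : R := (2^-1) ^+ n * \sum_b f b.

Lemma avg_cst (c : R) : avg (fun=> c) = c.
Proof.
rewrite /avg sumr_const card_tuple card_bool -(mulr_natr c) natrX mulrCA -exprMn.
by rewrite mulVf ?expr1n ?mulr1.
Qed.

Lemma avg_ge0 f : (forall b, 0 <= f b) -> 0 <= avg f.
Proof. by move=> f0; rewrite mulr_ge0 ?exprn_ge0 ?invr_ge0// sumr_ge0. Qed.

Lemma avg_le f g : (forall b, f b <= g b) -> avg f <= avg g.
Proof. by move=> fg; rewrite ler_wpM2l ?exprn_ge0 ?invr_ge0//; exact: ler_sum. Qed.

Lemma avgZl (c : R) f : avg (fun b => c * f b) = c * avg f.
Proof. by rewrite /avg -mulr_sumr mulrCA. Qed.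

(** Two independent spikes appear here, which is how overlaps enter second moments. *)
Lemma avgM f g : avg f * avg g = avg (fun b => avg (fun b' => f b * g b')).
Proof. by rewrite mulrC -avgZl; congr avg; apply/funext => b; rewrite mulrC -avgZl. Qed.

Lemma measurable_avg (f : n.-tuple bool -> tensor R d n -> R) :
  (forall b, measurable_fun setT (f b)) -> measurable_fun setT (fun G => avg (f ^~ G)).
Proof. by move=> mf; apply: measurable_funM => //; exact: measurable_sum. Qed.

Let ell b G : R := tlik lam eta (rade_vec b) G.

Let ell_ge0 b G : 0 <= ell b G. Proof. exact: tlik_ge0. Qed.

Let mell b : measurable_fun setT (ell b). Proof. exact: measurable_tlik. Qed.

Let rade1 (b : n.-tuple bool) : dot (rade_vec b) (rade_vec b) = 1 :> R.
Proof. exact: dot_rade_vecxx. Qed.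

(** With w = 1 this is the square of the averaged truncated ratio; with w(t) = |t|^d it dominates
    the squared norm of the likelihood-weighted mean of the spike tensors. *)
Let pairs w G : R := avg (fun b => avg (fun b' =>
  w (dot (rade_vec b) (rade_vec b')) * (ell b G * ell b' G))).

Let K : R := lam ^+ 2 / 2 + lam * eta.

Local Open Scope ereal_scope.

Lemma ge0_integral_avg (f : n.-tuple bool -> tensor R d n -> R) :
  (forall b, measurable_fun setT (f b)) -> (forall b G, 0 <= f b G)%R ->
  \int[noise d n]_G (avg (f ^~ G))%:E =
  ((2^-1) ^+ n)%:E * \sum_b \int[noise d n]_G (f b G)%:E.
Proof.
move=> mf f0; rewrite ge0_integralZl_EFinM; last 3 first.
- exact: measurable_sum.
- by move=> G; exact: sumr_ge0.
- by rewrite exprn_ge0 ?invr_ge0.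
by rewrite ge0_integral_sum_EFin.
Qed.

Lemma le_integral_avg (f : n.-tuple bool -> tensor R d n -> R) (c : n.-tuple bool -> R) :
  (forall b, measurable_fun setT (f b)) -> (forall b G, 0 <= f b G)%R ->
  (forall b, \int[noise d n]_G (f b G)%:E <= (c b)%:E) ->
  \int[noise d n]_G (avg (f ^~ G))%:E <= (avg c)%:E.
Proof.
move=> mf f0 fc; rewrite ge0_integral_avg// EFinM -sumEFin lee_pmul2l//.
  exact: lee_sum.
Qed.

(** For each fixed first spike, [integral_tlik2] reduces the average over the second to
    [second_moment_bound], whose value does not depend on the first. *)
Lemma integral_pairs_le w (c delta omega : R) :
  (3 <= d)%N -> (0 <= c < 1)%R -> (0 <= delta <= 1)%R -> (0 <= omega)%R ->
  (forall t, -1 <= t <= 1 -> K * (`|t| ^+ d / (1 + `|t| ^+ d)) <= c * f_rade t)%R ->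
  (forall t, 0 <= w t)%R -> (forall t, `|t| <= 1 -> w t <= 1)%R ->
  (forall t, `|t| <= delta -> w t <= omega)%R ->
  \int[noise d n]_G (pairs w G)%:E <=
  (omega * expR (n%:R * K * delta ^+ 3) +
   n.+1%:R * expR (- (n%:R * (1 - c) * delta ^+ 2 / 6)))%:E.
Proof.
move=> d3 c01 de01 om0 HK w0 w1 wom.
have K0 : (0 <= K)%R by rewrite addr_ge0 ?mulr_ge0 ?exprn_ge0.
set U := (X in _ <= X%:E).
rewrite -(avg_cst U).
have mpair b b' : measurable_fun setT (fun G =>
    w (dot (rade_vec b) (rade_vec b')) * (ell b G * ell b' G))%R.
  by apply: measurable_funM => //; exact: measurable_funM.
have pair0 b b' G : (0 <= w (dot (rade_vec b) (rade_vec b')) * (ell b G * ell b' G))%R.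
  by apply: mulr_ge0; [exact: w0|apply: mulr_ge0; exact: ell_ge0].
apply: le_integral_avg => [b|b G|b].
- exact: (measurable_avg (mpair b)).
- exact: avg_ge0.
apply: (@le_trans _ _ (avg (fun b' => let t := overlap n (agree b b') in
     w t * expR (n%:R * K * (`|t| ^+ d / (1 + `|t| ^+ d))))%R)%:E); last first.
  rewrite lee_fin; apply: second_moment_bound => // t t1.
  by rewrite w0 w1// ler_norml.
apply: le_integral_avg => // b' /=.
rewrite -dot_rade_vec// ge0_integralZl_EFinM//; last 2 first.
- exact: measurable_funM.
- by move=> G; rewrite mulr_ge0.
rewrite EFinM lee_wpmul2l ?lee_fin//.
exact: integral_tlik2.
Qed.

Let Lt G : R := avg (ell ^~ G).

Let e : R := expR (- (n%:R * eta ^+ 2 / 4)).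

Lemma integral_avg_tlik_ge : (1 - e)%:E <= \int[noise d n]_G (Lt G)%:E.
Proof.
rewrite ge0_integral_avg// -[leLHS](mule1).
rewrite -(avg_cst (1 - e)) mule1 /avg EFinM -sumEFin lee_pmul2l//.
  by apply: lee_sum => b _; rewrite EFinB; exact: integral_tlik_ge.
Qed.

(* Replacing the likelihood ratio by its truncation costs the mass [e] of the
   atypical event. *)
Lemma integral_lik_trunc (phi : n.-tuple bool -> tensor R d n -> R) :
  (forall b, measurable_fun setT (phi b)) -> (forall b G, 0 <= phi b G <= 1)%R ->
  ((2^-1) ^+ n)%:E * \sum_b \int[noise d n]_G (phi b G * lik lam (rade_vec b) G)%:E <=
  \int[noise d n]_G (avg (fun b => phi b G * ell b G))%:E + e%:E.
Proof.
move=> mphi phi01.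
have phi0 b G : (0 <= phi b G)%R by have /andP[] := phi01 b G.
have phi1 b G : (phi b G <= 1)%R by have /andP[] := phi01 b G.
have N0 : 0 < ((2^-1) ^+ n : R)%:E by rewrite lte_fin exprn_gt0// invr_gt0.
rewrite ge0_integral_avg; last 2 first.
- by move=> b; exact: measurable_funM.
- by move=> b G; rewrite mulr_ge0.
rewrite -[in leRHS](avg_cst e) /avg EFinM -sumEFin -ge0_muleDr; last 2 first.
- by apply: sume_ge0 => b _; apply: integral_ge0 => G _; rewrite lee_fin mulr_ge0.
- by apply: sume_ge0 => b _; rewrite lee_fin expR_ge0.
rewrite lee_pmul2l// -big_split/=; apply: lee_sum => b _.
have mat : measurable_fun setT (fun G => lik lam (rade_vec b) G *
    \1_(~` typical lam eta (rade_vec b)) G)%R.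
  apply: measurable_funM; first exact: measurable_lik.
  by apply: measurable_indic; apply: measurableC; exact: measurable_typical.
have := leeD2l (\int[noise d n]_G (phi b G * ell b G)%:E)
  (@integral_lik_atypical _ d _ n_gt0 lam _ _ (rade1 b) eta_ge0).
apply: le_trans.
rewrite -ge0_integralD_EFin//; last 3 first.
- exact: measurable_funM.
- by move=> G; rewrite mulr_ge0.
- by move=> G; rewrite mulr_ge0 ?lik_ge0.
apply: ge0_le_integral_EFin.
- by apply: measurable_funM => //; exact: measurable_lik.
- by apply: measurable_funD => //; exact: measurable_funM.
- by move=> G; rewrite mulr_ge0 ?lik_ge0.
move=> G; rewrite /ell /tlik !indicE in_setC.
have L0 := lik_ge0 lam (rade_vec b) G.
case: (G \in _) => /=; first by rewrite mulr1 mulr0 addr0.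
by rewrite !mulr0 add0r mulr1 ler_piMl.
Qed.

End averaged_likelihood.

(** * Detection and recovery *)

Section impossibility_bounds.
Context {R : realType} (d n : nat) (n_gt0 : (0 < n)%N).
Variables (lam eta : R).
Hypotheses (lam_ge0 : 0 <= lam) (eta_ge0 : 0 <= eta).
Implicit Types (G : tensor R d n).

Let ell (b : n.-tuple bool) G : R := tlik lam eta (rade_vec b) G.

Let ell_ge0 b G : 0 <= ell b G. Proof. exact: tlik_ge0. Qed.

Let mell b : measurable_fun setT (ell b). Proof. exact: measurable_tlik. Qed.

Let e : R := expR (- (n%:R * eta ^+ 2 / 4)).

Let pairs (w : R -> R) G : R := avg (fun b => avg (fun b' =>
  w (dot (rade_vec b) (rade_vec b')) * (ell b G * ell b' G))).

Let mpairs w : measurable_fun setT (pairs w).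
Proof.
apply: measurable_avg => b; apply: measurable_avg => b'.
by apply: measurable_funM => //; exact: measurable_funM.
Qed.

Let pairs_ge0 w G : (forall t, 0 <= w t) -> 0 <= pairs w G.
Proof.
move=> w0; apply: avg_ge0 => b; apply: avg_ge0 => b'.
by apply: mulr_ge0 => //; exact: mulr_ge0.
Qed.

Let measurable_avg_tlik : measurable_fun setT (fun G => avg (ell ^~ G)).
Proof. exact: measurable_avg. Qed.

Local Open Scope ereal_scope.

Lemma spikedWTE (A : set (tensor R d n)) : measurable A ->
  spikedWT d lam (@rademacher R) n A = ((2^-1) ^+ n)%:E * \sum_(b : n.-tuple bool)
    \int[noise d n]_G (\1_(@tensor_sym R d n @^-1` A) G * lik lam (rade_vec b) G)%:E.
Proof.
move=> mA.
have mF : measurable_fun setT (fun z : vec R n * tensor R d n => (\1_A z.2 : R)%:E).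
  by apply/measurable_EFinP; apply: (@measurableT_comp _ _ _ _ _ _ (\1_A : _ -> R)).
have mspA : measurable (@spike R d n lam @^-1` A).
  by rewrite -[_ @^-1` _]setTI; exact: measurable_spike.
transitivity (\int[signal_noise d (@rademacher R) n]_z (\1_A (spike lam z))%:E).
  rewrite -[RHS]/(\int[_]_z (\1_(@spike R d n lam @^-1` A) z)%:E).
  by rewrite integral_indic ?setIT.
apply: etrans (@ge0_integral_spike _ lam d n (fun z => (\1_A z.2)%:E) n_gt0 mF _) _.
  by move=> z; rewrite lee_fin.
by congr (_ * _); apply: eq_bigr => b _; apply: eq_integral => G _; rewrite -EFinM.
Qed.

(* Second moment method: integrate [0 <= (k 1_B - (L - 1))^2], with [k^2 1_B]
   bounded by [k^2], where [L] is the averaged truncated likelihood ratio. *)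
Lemma success_prob_le (A : set (tensor R d n)) (U k : R) :
  measurable A -> (0 < k)%R ->
  \int[noise d n]_G (pairs (fun=> 1%R) G)%:E <= U%:E ->
  success_prob lam (@rademacher R) A <=
  (2^-1 + 2^-1 * (e + k / 2 + (U - 1 + 2 * e) / (2 * k)))%:E.
Proof.
move=> mA k0 hU.
pose B := @tensor_sym R d n @^-1` A.
have mB : measurable B.
  by rewrite -[B]setTI; exact: measurable_tensor_sym.
have m1 : measurable_fun setT (\1_B : _ -> R) by exact: measurable_indic.
have B01 G : (0 <= (\1_B G : R) <= 1)%R.
  by rewrite indicE; case: (G \in B) => /=; rewrite lexx ler01.
have B0 G : (0 <= \1_B G :> R)%R by have /andP[] := B01 G.
have B1 G : (\1_B G <= 1 :> R)%R by have /andP[] := B01 G.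
pose L G : R := avg (ell ^~ G).
have L0 G : (0 <= L G)%R by exact: avg_ge0.
have L2 G : (L G * L G = pairs (fun=> 1) G)%R.
  rewrite avgM /pairs; congr avg; apply/funext => b; congr avg; apply/funext => b'.
  by rewrite mul1r.
have intL : \int[noise d n]_G (L G)%:E <= 1%:E.
  by rewrite -(@avg_cst R n 1); apply: le_integral_avg => // b; exact: integral_tlik_le1.
have [l El /andP[l0 l1]] : exists2 l : R,
    \int[noise d n]_G (L G)%:E = l%:E & (0 <= l <= 1)%R.
  apply: le_EFin_decomp intL; apply: integral_ge0 => G _; by rewrite lee_fin.
have el : (1 - e <= l)%R by rewrite -lee_fin -El; exact: integral_avg_tlik_ge.
have [s Es /andP[s0 sU]] : exists2 s : R,
    \int[noise d n]_G (pairs (fun=> 1%R) G)%:E = s%:E & (0 <= s <= U)%R.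
  apply: le_EFin_decomp hU; apply: integral_ge0 => G _.
  by rewrite lee_fin; exact: pairs_ge0.
have mBL : measurable_fun setT (fun G => \1_B G * L G)%R by exact: measurable_funM.
have intBL : \int[noise d n]_G (\1_B G * L G)%:E <= 1%:E.
  apply: le_trans intL; apply: ge0_le_integral_EFin => //.
  - by move=> G; rewrite mulr_ge0.
  - by move=> G; rewrite ler_piMl.
have [p Ep /andP[p0 p1]] : exists2 p : R,
    \int[noise d n]_G (\1_B G * L G)%:E = p%:E & (0 <= p <= 1)%R.
  apply: le_EFin_decomp intBL; apply: integral_ge0 => G _; by rewrite lee_fin mulr_ge0.
have WTA : WT R d n A = \int[noise d n]_G (\1_B G)%:E.
  by rewrite integral_indic ?setIT.
have [q Eq /andP[q0 q1]] : exists2 q : R, WT R d n A = q%:E & (0 <= q <= 1)%R.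
  by apply: le_EFin_decomp => //; exact: probability_le1.
have WTC : WT R d n (~` A) = (1 - q)%:E by rewrite probability_setC// Eq EFinB.
have spA : spikedWT d lam (@rademacher R) n A <= (p + e)%:E.
  rewrite spikedWTE// EFinD -Ep.
  apply: le_trans (integral_lik_trunc n_gt0 lam eta_ge0 (fun=> m1) (fun=> B01)) _.
  rewrite le_eqVlt; apply/orP; left; apply/eqP; congr (_ + _).
  by apply: eq_integral => G _; rewrite /L -avgZl.
(* The integrated square, with negative terms moved across so that only nonnegative functions are
   integrated; [p], [l], [q], [s] are the integrals of 1_B L, L, 1_B and L^2. *)
have key c : (c = k ^+ 2 + 1 -> 2 * k * p + 2 * l <= 2 * k * q + c + s)%R.
  move=> cE.
  have mk2 : measurable_fun setT (fun _ : tensor R d n => c) by [].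
  have k20 : (0 <= 2 * k)%R by rewrite mulr_ge0// ltW.
  have c0 : (0 <= c)%R by rewrite cE addr_ge0// sqr_ge0.
  rewrite -lee_fin !EFinD !(EFinM _ p) !(EFinM _ l) !(EFinM _ q) -Ep -El -Es -Eq WTA.
  have -> : c%:E = \int[noise d n]_G c%:E.
    by rewrite integral_cst//= probability_setT mule1.
  have mL : measurable_fun setT L := measurable_avg_tlik.
  have BL0 G : (0 <= \1_B G * L G)%R by rewrite mulr_ge0.
  have P0 G : (0 <= pairs (fun=> 1) G)%R by exact: pairs_ge0.
  have m2k (f : tensor R d n -> R) : measurable_fun setT f ->
      measurable_fun setT (fun G : tensor R d n => 2 * k * f G)%R.
    by move=> mf; apply: measurable_funM.
  have m2 (f : tensor R d n -> R) : measurable_fun setT f ->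
      measurable_fun setT (fun G : tensor R d n => 2 * f G)%R.
    by move=> mf; apply: measurable_funM.
  rewrite -!ge0_integralZl_EFinM//.
  rewrite -(ge0_integralD_EFin _ (m2k _ mBL) (m2 _ mL)); last 2 first.
  - by move=> G; apply: mulr_ge0.
  - by move=> G; apply: mulr_ge0.
  rewrite -(ge0_integralD_EFin _ (m2k _ m1) mk2); last 2 first.
  - by move=> G; apply: mulr_ge0.
  - by move=> G.
  rewrite -ge0_integralD_EFin//; last 2 first.
  - by apply: measurable_funD; [exact: m2k|exact: mk2].
  - by move=> G; rewrite addr_ge0// mulr_ge0.
  apply: ge0_le_integral_EFin.
  - by apply: measurable_funD; [exact: m2k|exact: m2].
  - by apply: measurable_funD => //; apply: measurable_funD; [exact: m2k|exact: mk2].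
  - by move=> G; rewrite addr_ge0// mulr_ge0.
  move=> G; rewrite -L2 indicE cE; have := sqr_ge0 (k * (G \in B)%:R - (L G - 1))%R.
  by have := sqr_ge0 k; case: (G \in B) => /=; lra.
have {}key := key _ erefl.
(* l >= 1 - e and s <= U leave 2 k (p - q) <= k^2 + U - 1 + 2 e. *)
have kV : (p - q <= e + k / 2 + (U - 1 + 2 * e) / (2 * k) - e)%R.
  have k20 : (0 < 2 * k)%R by rewrite mulr_gt0.
  rewrite -(ler_pM2l k20).
  have -> : (2 * k * (e + k / 2 + (U - 1 + 2 * e) / (2 * k) - e) =
      k ^+ 2 + (U - 1 + 2 * e))%R.
    by field; rewrite gt_eqF.
  by lra.
rewrite /success_prob WTC.
apply: (@le_trans _ _ ((2^-1)%:E * (p + e)%:E + (2^-1)%:E * (1 - q)%:E)).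
  by rewrite leeD2r// lee_wpmul2l// lee_fin invr_ge0.
by rewrite -!EFinM -EFinD lee_fin; lra.
Qed.

Let corr (y : vec R n) (b : n.-tuple bool) : R := (dot (rade_vec b) y ^+ d)%R.

(* Both sides are inner products of tensors: the left one is <V, y^{(x) d}> for
   V the likelihood-weighted average of the x^{(x) d}, and |y^{(x) d}| = 1. *)
Lemma avg_corr_le (y : vec R n) (G : tensor R d n) (k : R) : (0 < k)%R -> dot y y = 1%R ->
  (avg (fun b => corr y b * ell b G) <=
   k / 2 + (2 * k)^-1 * pairs (fun t => `|t| ^+ d) G)%R.
Proof.
move=> k0 y1.
pose V j : R := avg (fun b => tnth (tensor_pow d (rade_vec b)) j * ell b G)%R.
have dotV : avg (fun b => corr y b * ell b G)%R = (\sum_j V j * tnth (tensor_pow d y) j)%R.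
  rewrite /avg mulr_sumr.
  under [RHS]eq_bigr => j _ do rewrite /V /avg -mulrA mulr_suml mulr_sumr.
  rewrite exchange_big/=; apply: eq_bigr => b _.
  rewrite /corr -dot_tensor_pow /dot mulr_suml mulr_sumr; apply: eq_bigr => j _.
  by rewrite mulrAC.
have VV : (\sum_j V j ^+ 2 <= pairs (fun t => `|t| ^+ d) G)%R.
  have -> : (\sum_j V j ^+ 2 = avg (fun b => avg (fun b' =>
      dot (rade_vec b) (rade_vec b') ^+ d * (ell b G * ell b' G))))%R.
    under eq_bigr => j _ do rewrite expr2 avgM.
    rewrite /avg -mulr_sumr; congr (_ * _)%R; rewrite exchange_big/=; apply: eq_bigr => b _.
    rewrite -mulr_sumr; congr (_ * _)%R; rewrite exchange_big/=; apply: eq_bigr => b' _.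
    rewrite -dot_tensor_pow /dot mulr_suml; apply: eq_bigr => j _.
    by rewrite mulrACA.
  apply: avg_le => b; apply: avg_le => b'.
  apply: ler_wpM2r; first by rewrite mulr_ge0. by rewrite -normrX ler_norm.
have yy : (\sum_j tnth (tensor_pow d y) j ^+ 2 = 1)%R.
  by rewrite -(expr1n _ d) -y1 -dot_tensor_pow; apply: eq_bigr => j _; rewrite expr2.
rewrite dotV.
(* Cauchy-Schwarz in the form a c <= k c^2 / 2 + a^2 / (2 k), entry by entry. *)
apply: (@le_trans _ _ (\sum_j (k / 2 * tnth (tensor_pow d y) j ^+ 2 + (2 * k)^-1 * V j ^+ 2))%R).
  apply: ler_sum => j _; move: (V j) (tnth _ j) => a c.
  have k20 : (0 < 2 * k)%R by rewrite mulr_gt0.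
  rewrite -(ler_pM2l k20).
  have -> : (2 * k * (k / 2 * c ^+ 2 + (2 * k)^-1 * a ^+ 2) = k ^+ 2 * c ^+ 2 + a ^+ 2)%R.
    by field; rewrite gt_eqF.
  by have := sqr_ge0 (k * c - a)%R; lra.
rewrite big_split/= -!mulr_sumr yy mulr1 lerD2l ler_wpM2l//.
by rewrite invr_ge0 mulr_ge0// ltW.
Qed.

(** For fixed noise the estimate is a fixed unit vector, so [avg_corr_le] bounds the truncated
    correlation pointwise, and integration leaves the weighted second moment. *)
Lemma recovery_le (xhat : tensor R d n -> vec R n) (U k : R) :
  measurable_fun setT xhat -> (forall T, is_unit_vector (xhat T)) -> (0 < k)%R ->
  \int[noise d n]_G (pairs (fun t => `|t| ^+ d)%R G)%:E <= U%:E ->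
  'E_(signal_noise d (@rademacher R) n)[
     (fun z => dot z.1 (xhat (spike lam z)) ^+ d)%R] <=
  (e + k / 2 + U / (2 * k))%:E.
Proof.
move=> mx x1 k0 hU.
pose D (z : vec R n * tensor R d n) : R := (dot z.1 (xhat z.2) ^+ d)%R.
have mD : measurable_fun setT D.
  apply: measurable_funX; apply: measurable_sum => i.
  apply: measurable_funM.
    exact: (measurableT_comp (measurable_tnth i) measurable_fst).
  apply: (measurableT_comp (measurable_tnth i)).
  exact: (measurableT_comp mx measurable_snd).
(* For odd [d] the correlation is signed, while the change of measure is for nonnegative functions:
   positive and negative parts are treated apart. *)
pose pos (r : R) : R := (Num.max r 0)%R; pose neg (r : R) : R := (Num.max (- r) 0)%R.
have mpos : measurable_fun setT (pos \o D) by apply: measurable_maxr.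
have mneg : measurable_fun setT (neg \o D).
  by apply: measurable_maxr => //; exact: measurableT_comp.
have pos0 r : (0 <= pos r)%R by rewrite /pos le_max lexx orbT.
have neg0 r : (0 <= neg r)%R by rewrite /neg le_max lexx orbT.
have posneg r : (pos r - neg r = r)%R.
  rewrite /pos /neg /=; have [r0|/ltW r0] := leP 0%R r.
    have r0' : (- r <= 0)%R by rewrite oppr_le0.
    by rewrite (max_r r0') subr0.
  have r0' : (0 <= - r)%R by rewrite oppr_ge0.
  by rewrite (max_l r0') sub0r opprK.
pose p b G := pos (D (rade_vec b, tensor_sym G)).
pose m b G := neg (D (rade_vec b, tensor_sym G)).
have absD b G : (`|D (rade_vec b, tensor_sym G)| <= 1)%R.
  rewrite normrX exprn_ile1// dot_le1//; last exact: x1.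
  exact: dot_rade_vecxx.
have p01 b G : (0 <= p b G <= 1)%R.
  by rewrite pos0/= /p /pos ge_max ler01 (le_trans (ler_norm _)).
have m01 b G : (0 <= m b G <= 1)%R.
  by rewrite neg0/= /m /neg ge_max ler01 (le_trans (ler_norm _))// normrN.
have msym b : measurable_fun setT
    (fun G => (rade_vec b : vec R n, tensor_sym G : tensor R d n)).
  by apply: measurable_fun_pair => //; exact: measurable_tensor_sym.
have mp b : measurable_fun setT (p b) by exact: (measurableT_comp mpos (msym b)).
have mm b : measurable_fun setT (m b) by exact: (measurableT_comp mneg (msym b)).
have p0 b G : (0 <= p b G)%R by exact: pos0.
have m0 b G : (0 <= m b G)%R by exact: neg0.
have N0 : 0 <= ((2^-1) ^+ n : R)%:E by rewrite lee_fin exprn_ge0// invr_ge0.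
rewrite expectation.unlock integralE.
set P := (X in X - _); set M := (X in _ - X).
have PE : P = ((2^-1) ^+ n)%:E * \sum_b \int[noise d n]_G (p b G * lik lam (rade_vec b) G)%:E.
  apply: etrans (@ge0_integral_spike _ lam d n (fun z => (pos (D z))%:E) n_gt0 _ _).
  - by apply: eq_integral => z _; rewrite funeposE EFin_max.
  - exact/measurable_EFinP.
  - by move=> z; rewrite lee_fin.
have ME : M = ((2^-1) ^+ n)%:E * \sum_b \int[noise d n]_G (m b G * lik lam (rade_vec b) G)%:E.
  apply: etrans (@ge0_integral_spike _ lam d n (fun z => (neg (D z))%:E) n_gt0 _ _).
  - by apply: eq_integral => z _; rewrite funenegE EFin_max.
  - exact/measurable_EFinP.
  - by move=> z; rewrite lee_fin.
(* Truncation costs [e] in the positive part only; in the negative part it goes in the favourable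
   direction. *)
have Ple : P <= \int[noise d n]_G (avg (fun b => p b G * ell b G)%R)%:E + e%:E.
  by rewrite PE; exact: integral_lik_trunc.
have Mge : \int[noise d n]_G (avg (fun b => m b G * ell b G)%R)%:E <= M.
  rewrite ME ge0_integral_avg; last 2 first.
  - by move=> b; exact: measurable_funM.
  - by move=> b G; rewrite mulr_ge0.
  apply: lee_wpmul2l => //; apply: lee_sum => b _; apply: ge0_le_integral_EFin.
  - exact: measurable_funM.
  - by apply: measurable_funM => //; exact: measurable_lik.
  - by move=> G; rewrite mulr_ge0.
  move=> G; rewrite ler_wpM2l// /ell /tlik ler_piMr ?lik_ge0// indicE; exact: lern1_bool.
(* Finiteness of [M] allows it to be moved across the inequality. *)
have M1 : M <= 1%:E.
  rewrite ME -[X in _ <= X%:E](@avg_cst R n 1) /avg EFinM -sumEFin; apply: lee_wpmul2l => //.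
  apply: lee_sum => b _; rewrite -(@integral_lik _ d _ n_gt0 lam (rade_vec b)).
  apply: ge0_le_integral_EFin.
  - by apply: measurable_funM => //; exact: measurable_lik.
  - exact: measurable_lik.
  - by move=> G; rewrite mulr_ge0 ?lik_ge0.
  by move=> G; rewrite ler_piMl ?lik_ge0//; have /andP[] := m01 b G.
have [M' EM _] : exists2 M' : R, M = M'%:E & (0 <= M' <= 1)%R.
  apply: le_EFin_decomp M1; apply: le_trans Mge; apply: integral_ge0 => G _.
  by rewrite lee_fin; apply: avg_ge0 => b; rewrite mulr_ge0.
have k20 : (0 <= (2 * k)^-1)%R by rewrite invr_ge0 mulr_ge0// ltW.
have k0' : (0 <= k / 2)%R by rewrite divr_ge0// ltW.
have mavg (f : n.-tuple bool -> tensor R d n -> R) : (forall b, measurable_fun setT (f b)) ->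
    measurable_fun setT (fun G => avg (fun b => f b G * ell b G))%R.
  move=> mf; apply: (@measurable_avg R d n (fun b G => f b G * ell b G)%R) => b.
  exact: measurable_funM.
have key : \int[noise d n]_G (avg (fun b => p b G * ell b G)%R)%:E <=
    M + (k / 2 + U / (2 * k))%:E.
  apply: (@le_trans _ _ (\int[noise d n]_G (avg (fun b => m b G * ell b G) +
      (k / 2 + (2 * k)^-1 * pairs (fun t => `|t| ^+ d) G))%R%:E)).
    apply: ge0_le_integral_EFin.
    - exact: mavg.
    - apply: measurable_funD; first exact: mavg.
      by apply: measurable_funD => //; apply: measurable_funM.
    - by move=> G; apply: avg_ge0 => b; rewrite mulr_ge0.
    move=> G; rewrite -lerBlDl; have := avg_corr_le G k0 (x1 (tensor_sym G)).
    apply: le_trans; rewrite le_eqVlt; apply/orP; left; apply/eqP.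
    rewrite /avg -mulrBr -sumrB; congr (_ * _)%R; apply: eq_bigr => b _.
    by rewrite -mulrBl posneg.
  have Pr0 G : (0 <= pairs (fun t => `|t| ^+ d) G)%R.
    by apply: pairs_ge0 => t; rewrite exprn_ge0.
  rewrite ge0_integralD_EFin; last 4 first.
  - exact: mavg.
  - by apply: measurable_funD => //; apply: measurable_funM.
  - by move=> G; apply: avg_ge0 => b; rewrite mulr_ge0.
  - by move=> G; rewrite addr_ge0// mulr_ge0.
  apply: leeD => //.
  rewrite ge0_integralD_EFin//; last 2 first.
  - by apply: measurable_funM.
  - by move=> G; rewrite mulr_ge0.
  rewrite integral_cst//= probability_setT mule1 ge0_integralZl_EFinM// EFinD leeD2l//.
  by rewrite (mulrC U) EFinM; apply: lee_wpmul2l.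
rewrite EM leeBlDr//.
apply: le_trans Ple _.
apply: le_trans (leeD2r e%:E key) _.
by rewrite EM -!EFinD lee_fin; lra.
Qed.

End impossibility_bounds.

(** * Choice of the dimension and of the overlap cutoff *)

Section asymptotics.
Context {R : realType}.

(** With M = m + 1: n delta^3 = 1/M tames the near overlaps, and n delta^2 = M gives an exponential
    decay that beats the n + 1 agreement counts. *)
Lemma moment_bounds_small (K c eta eps : R) : 0 <= K -> c < 1 -> 0 < eta -> 0 < eps ->
  \forall m \near \oo,
    let n := (m.+1 ^ 5)%N in let delta := (m.+1%:R ^+ 2)^-1 in
    let tail := n.+1%:R * expR (- (n%:R * (1 - c) * delta ^+ 2 / 6)) in
    [/\ 1 * expR (n%:R * K * delta ^+ 3) + tail <= 1 + eps,
        delta * expR (n%:R * K * delta ^+ 3) + tail <= eps &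
        expR (- (n%:R * eta ^+ 2 / 4)) <= eps].
Proof.
move=> K0 c1 eta0 eps0.
pose a := (1 - c) / 6; have a0 : 0 < a by rewrite /a; lra.
(* From exp (a M) >= (a M / 6)^6 and M^5 + 1 <= 2 M^5, the tail is at most C / M. *)
pose C := 2 * (6 / a) ^+ 6.
have C0 : 0 < C by rewrite mulr_gt0// exprn_gt0// divr_gt0.
(* Bounds on 1/M that ensure, in turn, exp (K/M) <= 1 + eps/2, tail <= eps/2, atypical mass <= eps,
   and delta exp (K/M) <= eps/2. *)
have mu1 : 0 < eps / (2 + eps) / (K + 1) by rewrite !divr_gt0//; lra.
have mu2 : 0 < eps / 2 / C by rewrite !divr_gt0.
have mu3 : 0 < eps / (4 / eta ^+ 2) by rewrite !divr_gt0// exprn_gt0.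
have mu4 : 0 < eps / 2 / (1 + eps / 2) by rewrite !divr_gt0//; lra.
near=> m => /=.
have h1 : (m.+1%:R : R)^-1 < eps / (2 + eps) / (K + 1).
  by near: m; exact: (near_infty_natSinv_lt (PosNum mu1)).
have h2 : (m.+1%:R : R)^-1 < eps / 2 / C.
  by near: m; exact: (near_infty_natSinv_lt (PosNum mu2)).
have h3 : (m.+1%:R : R)^-1 < eps / (4 / eta ^+ 2).
  by near: m; exact: (near_infty_natSinv_lt (PosNum mu3)).
have h4 : (m.+1%:R : R)^-1 < eps / 2 / (1 + eps / 2).
  by near: m; exact: (near_infty_natSinv_lt (PosNum mu4)).
pose M : R := m.+1%:R; pose x := M^-1.
have M1 : 1 <= M by rewrite ler1n.
have M0 : 0 < M by lra.
have x0 : 0 < x by rewrite invr_gt0.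
have {}h1 : x * (K + 1) < eps / (2 + eps) by rewrite -ltr_pdivlMr//; lra.
have {}h2 : x * C < eps / 2 by rewrite -ltr_pdivlMr.
have {}h3 : x * (4 / eta ^+ 2) < eps by rewrite -ltr_pdivlMr// divr_gt0// exprn_gt0.
have {}h4 : x * (1 + eps / 2) < eps / 2 by rewrite -ltr_pdivlMr//; lra.
rewrite -[m.+1%:R]/M.
have nM : (m.+1 ^ 5)%:R = M ^+ 5 :> R by rewrite natrX.
have nM1 : (m.+1 ^ 5).+1%:R = M ^+ 5 + 1 :> R by rewrite -natr1 nM.
rewrite nM1 nM.
have e3 : M ^+ 5 * K * (M ^+ 2)^-1 ^+ 3 = K * x by rewrite /x; field; rewrite gt_eqF.
have e2 : M ^+ 5 * (1 - c) * (M ^+ 2)^-1 ^+ 2 / 6 = a * M by rewrite /a; field; rewrite gt_eqF.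
rewrite e3 e2.
have E1 : expR (K * x) <= 1 + eps / 2.
  have y1 : K * x <= eps / (2 + eps).
    by apply: le_trans (ltW h1); rewrite mulrC ler_pM2l//; lra.
  apply: (@le_trans _ _ (expR (eps / (2 + eps)))); first by rewrite ler_expR.
  have y2 : 1 - eps / (2 + eps) = 2 / (2 + eps) by field; lra.
  rewrite -[expR _]invrK -expRN (_ : 1 + eps / 2 = (2 / (2 + eps))^-1); last by field; lra.
  rewrite lef_pV2 ?posrE ?expR_gt0 ?divr_gt0//; last by lra.
  by rewrite -y2; exact: expR_ge1Dx.
have E2 : (M ^+ 5 + 1) * expR (- (a * M)) <= eps / 2.
  have aM0 : 0 < a * M / 6 by rewrite divr_gt0// mulr_gt0.
  have l1 : (a * M / 6) ^+ 6 <= expR (a * M).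
    rewrite (_ : a * M = 6%:R * (a * M / 6)); last by field.
    rewrite expRM_natl (_ : 6 * (a * M / 6) / 6 = a * M / 6); last by field.
    rewrite lerXn2r ?nnegrE ?expR_ge0// ?(ltW aM0)//.
    by apply: le_trans (expR_ge1Dx _); rewrite lerDr.
  have l2 : expR (- (a * M)) <= ((a * M / 6) ^+ 6)^-1.
    by rewrite expRN lef_pV2// ?posrE ?expR_gt0// exprn_gt0.
  have l3 : M ^+ 5 + 1 <= 2 * M ^+ 5.
    have : 1 <= M ^+ 5 by exact: exprn_ege1.
    by lra.
  apply: (@le_trans _ _ (2 * M ^+ 5 * ((a * M / 6) ^+ 6)^-1)).
    by apply: ler_pM => //; rewrite ?expR_ge0// addr_ge0// exprn_ge0// ltW.
  apply: le_trans (ltW h2); rewrite /C /x le_eqVlt; apply/orP; left; apply/eqP.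
  by field; rewrite !gt_eqF.
have E3 : expR (- (M ^+ 5 * eta ^+ 2 / 4)) <= eps.
  have eta20 : 0 < eta ^+ 2 by rewrite exprn_gt0.
  have MM : M <= M ^+ 5 by rewrite -[leLHS]expr1 ler_weXn2l.
  rewrite expRN; apply: le_trans (ltW h3).
  rewrite (_ : x * (4 / eta ^+ 2) = (M * eta ^+ 2 / 4)^-1); last first.
    by rewrite /x; field; rewrite !gt_eqF.
  rewrite lef_pV2 ?posrE ?expR_gt0//; last by rewrite divr_gt0// mulr_gt0.
  apply: (@le_trans _ _ (M ^+ 5 * eta ^+ 2 / 4)).
    by rewrite ler_pM2r// ler_pM2r.
  by apply: le_trans (expR_ge1Dx _); rewrite lerDr.
split => //; first by rewrite mul1r; lra.
have dx : (M ^+ 2)^-1 <= x by rewrite /x lef_pV2 ?posrE ?exprn_gt0// -[leLHS]expr1 ler_weXn2l.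
have : (M ^+ 2)^-1 * expR (K * x) <= x * (1 + eps / 2).
  by apply: ler_pM; rewrite ?expR_ge0// invr_ge0 exprn_ge0// ltW.
move=> h5; rewrite [leRHS](splitr eps); apply: lerD => //; exact: le_trans h5 (ltW h4).
Unshelve. all: by end_near. Qed.

End asymptotics.

Theorem theorem4p5 (R : realType) (d : nat) (lam : R) :
  (3 <= d)%N -> 0 <= lam -> lam < lambda_rade R d ->
  ~ weak_detection d lam (@rademacher R) /\
  ~ weak_recovery d lam (@rademacher R).
Proof.
move=> d3 lam0 lamd.
have d0 : (0 < d)%N by exact: ltn_trans d3.
have [eta [c [eta0 /andP[c0 c1] HK]]] := lambda_rade_slack d0 lam0 lamd.
have K0 : 0 <= lam ^+ 2 / 2 + lam * eta.
  by rewrite addr_ge0// ?divr_ge0 ?sqr_ge0// mulr_ge0// ltW.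
have c01 : 0 <= c < 1 by rewrite c0.
have delta01 m : 0 <= (m.+1%:R ^+ 2 : R)^-1 <= 1.
  rewrite invr_ge0 exprn_ge0//= invf_le1 ?exprn_gt0 ?ltr0n//.
  by apply: exprn_ege1; rewrite ler1n.
have le_pow5 m : (m <= m.+1 ^ 5)%N.
  by rewrite (leq_trans (leqnSn m))// -[X in (X <= _)%N]expn1 leq_pexp2l.
(* Both bounds are used with k = eps: e <= ep < eps/8, k/2 = eps/2 and a last term at most 3 ep / (2
   eps) < eps/4 add up to less than eps. The factor eps / (1 + eps) in the witness is below both 1
   and eps. *)
have slack (eps : R) : 0 < eps -> exists ep : R,
    [/\ 0 < ep, ep < eps / 8 & 3 * ep / (2 * eps) < eps / 4].
  move=> eps0; exists (eps ^+ 2 / (8 * (1 + eps))).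
  have q0 : 0 < eps / (1 + eps) < 1.
    by rewrite divr_gt0 ?ltr_pdivrMr//=; lra.
  have q1 : eps / (1 + eps) < eps by rewrite ltr_pdivrMr; nra.
  have epE : eps ^+ 2 / (8 * (1 + eps)) = eps / 8 * (eps / (1 + eps)) by field; lra.
  rewrite epE; split; [by rewrite mulr_gt0//; lra|by rewrite gtr_pMr//; lra|].
  have -> : 3 * (eps / 8 * (eps / (1 + eps))) / (2 * eps) = 3 / 16 * (eps / (1 + eps)).
    by field; rewrite gt_eqF//; lra.
  by lra.
split=> -[eps [eps0]]; have [ep [ep0 ep8 ep4]] := slack _ eps0;
  have [m0 _ Hm] := moment_bounds_small K0 c1 eta0 ep0.
- move=> [A [mA [N _ HA]]].
  (* m >= m0 gives the estimates and n >= m >= N the assumed advantage; this single dimension yields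
     the contradiction. *)
  pose m := maxn m0 N; pose n := (m.+1 ^ 5)%N.
  have [U1 _ E] := Hm m (leq_maxl _ _).
  have n0 : (0 < n)%N by rewrite expn_gt0.
  have := HA n (leq_trans (leq_maxr m0 N) (le_pow5 m)).
  apply/negP; rewrite -ltNge.
  have := @integral_pairs_le _ d n n0 lam eta lam0 (ltW eta0) (fun=> 1) c _ 1 d3 c01
    (delta01 m) ler01 HK (fun=> ler01) (fun _ _ => lexx _) (fun _ _ => lexx _).
  move: U1; set U := 1 * _ + _ => U1 hU.
  apply: le_lt_trans
    (@success_prob_le _ d n n0 lam eta (ltW eta0) _ U eps (mA n) eps0 hU) _.
  rewrite lte_fin; set e := expR _ in E *.
  suff : (U - 1 + 2 * e) / (2 * eps) <= 3 * ep / (2 * eps) by lra.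
  by rewrite ler_pM2r ?invr_gt0 ?mulr_gt0//; lra.
- move=> [xhat [mx [x1 [N _ HN]]]].
  pose m := maxn m0 N; pose n := (m.+1 ^ 5)%N.
  have [_ U2 E] := Hm m (leq_maxl _ _).
  have n0 : (0 < n)%N by rewrite expn_gt0.
  have := HN n (leq_trans (leq_maxr m0 N) (le_pow5 m)).
  apply/negP; rewrite -ltNge.
  have w0 (t : R) : 0 <= `|t| ^+ d by rewrite exprn_ge0.
  have w1 (t : R) : `|t| <= 1 -> `|t| ^+ d <= 1 by move=> t1; rewrite exprn_ile1.
  (* Here omega = delta; this extra factor on near overlaps makes the second moment small instead of
     close to 1. *)
  have wd (t : R) : `|t| <= (m.+1%:R ^+ 2)^-1 -> `|t| ^+ d <= (m.+1%:R ^+ 2)^-1.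
    move=> td; apply: le_trans (td); rewrite -[leRHS]expr1 ler_wiXn2l//.
    by apply: le_trans td _; have /andP[] := delta01 m.
  have /andP[dm0 _] := delta01 m.
  have := @integral_pairs_le _ d n n0 lam eta lam0 (ltW eta0) (fun t => `|t| ^+ d) c _ _ d3 c01
    (delta01 m) dm0 HK w0 w1 wd.
  move: U2; set U := _ * expR _ + _ => U2 hU.
  apply: le_lt_trans
    (@recovery_le _ d n n0 lam eta (ltW eta0) _ U eps (mx n) (x1 n n0) eps0 hU) _.
  rewrite lte_fin; set e := expR _ in E *.
  suff : U / (2 * eps) <= 3 * ep / (2 * eps) by lra.
  by rewrite ler_pM2r ?invr_gt0 ?mulr_gt0//; lra.
Qed.
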